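(* Let $(H,\beta)$ be a cotriangular Hopf algebra over a field $k$ with $H$ commutative and cocommutative, and let $\sigma:H\otimes H\to k$ be a left cocycle. If $(\mathcal{A},\mathcal{H})$ is a matched pair of $(H,\beta)$-Lie algebras with actions $\triangleright:\mathcal{H}\otimes\mathcal{A}\to\mathcal{A}$ and $\triangleleft:\mathcal{H}\otimes\mathcal{A}\to\mathcal{H}$, then the cocycle twists $(\mathcal{A}^{\sigma},\mathcal{H}^{\sigma})$, with the twisted actions $\triangleright^{\sigma}$ and $\triangleleft^{\sigma}$, form a matched pair of $(H,\beta_{\sigma})$-Lie algebras. Furthermore, their double cross sum $\mathcal{A}^{\sigma}\bowtie\mathcal{H}^{\sigma}$ is an $(H,\beta_{\sigma})$-Lie algebra.
   Context: Notation: everything is over a field $k$. For a Hopf algebra $H$ write $\Delta(h)=h_1\otimes h_2$ (summation suppressed), with counit $\varepsilon$; for a left $H$-comodule $V$ write the coaction as $\rho(v)=v_{(-1)}\otimes v_{(0)}\in H\otimes V$. Tensor products of comodules carry the coaction $v\otimes w\mapsto v_{(-1)}w_{(-1)}\otimes v_{(0)}\otimes w_{(0)}$. The Hopf algebra $H$ is not to be confused with the Lie algebra $\mathcal{H}$. Cotriangular Hopf algebra: a pair $(H,\beta)$ with $H$ a Hopf algebra and $\beta:H\otimes H\to k$ a convolution-invertible bilinear map such that for all $h,g,l\in H$: (CT1) $\beta(h_1,g_1)g_2h_2=\beta(h_2,g_2)h_1g_1$; (CT2) $\beta(h,gl)=\beta(h_1,g)\beta(h_2,l)$; (CT3) $\beta(hg,l)=\beta(g,l_1)\beta(h,l_2)$;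 (CT4) $\beta(h_1,g_1)\beta(g_2,h_2)=\varepsilon(g)\varepsilon(h)$. Left cocycle: a convolution-invertible map $\sigma:H\otimes H\to k$ with $\sigma(h_1,g_1)\sigma(h_2g_2,l)=\sigma(g_1,l_1)\sigma(h,g_2l_2)$ for all $h,g,l\in H$; $\sigma^{-1}$ is its convolution inverse. Define $\beta_{\sigma}(h,l)=\sigma^{-1}(l_1,h_1)\beta(h_2,l_2)\sigma(h_3,l_3)$. The twisted Hopf algebra $H_\sigma$ is $H$ as a coalgebra with product $h\cdot_\sigma l=\sigma^{-1}(h_1,l_1)h_2l_2\sigma(h_3,l_3)$; since $H$ is commutative and cocommutative this is the product of $H$, so $H_\sigma=H$, and $(H,\beta_\sigma)$ is again cotriangular. $(H,\beta)$-Lie algebra: a left $H$-comodule $\mathcal{L}$ with an $H$-comodule morphism $[\,,]:\mathcal{L}\otimes\mathcal{L}\to\mathcal{L}$ such that for all $a,b,c\in\mathcal{L}$: (1) $[a,b]=-\beta(a_{(-1)},b_{(-1)})[b_{(0)},a_{(0)}]$; (2) $[[a,b],c]+\beta(a_{(-1)},b_{(-1)}c_{(-1)})[[b_{(0)},c_{(0)}],a_{(0)}]+\beta(a_{(-1)}b_{(-1)},c_{(-1)})[[c_{(0)},a_{(0)}],b_{(0)}]=0$. Modules: all action maps are required to be $H$-comodule maps, e.g. $\rho(h\triangleright a)=h_{(-1)}a_{(-1)}\otimes h_{(0)}\triangleright a_{(0)}$. Let $\mathcal{A},\mathcal{H}$ be $(H,\beta)$-Lie algebras. $\mathcal{A}$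 is a left $\mathcal{H}$-module via $\triangleright$ if $[h,g]\triangleright a=h\triangleright(g\triangleright a)-\beta(h_{(-1)},g_{(-1)})\,g_{(0)}\triangleright(h_{(0)}\triangleright a)$. $\mathcal{H}$ is a right $\mathcal{A}$-module via $\triangleleft$ if $h\triangleleft[a,b]=(h\triangleleft a)\triangleleft b-\beta(a_{(-1)},b_{(-1)})(h\triangleleft b_{(0)})\triangleleft a_{(0)}$. Matched pair of $(H,\beta)$-Lie algebras: a pair $(\mathcal{A},\mathcal{H})$ of $(H,\beta)$-Lie algebras such that $\mathcal{A}$ is a left $\mathcal{H}$-module via $\triangleright$, $\mathcal{H}$ is a right $\mathcal{A}$-module via $\triangleleft$, and for all $a,b\in\mathcal{A}$, $h,g\in\mathcal{H}$: (BB1) $h\triangleright[a,b]=[h\triangleright a,b]+\beta(h_{(-1)},a_{(-1)})[a_{(0)},h_{(0)}\triangleright b]+(h\triangleleft a)\triangleright b-\beta(a_{(-1)},b_{(-1)})(h\triangleleft b_{(0)})\triangleright a_{(0)}$; (BB2) $[h,g]\triangleleft a=[h,g\triangleleft a]+\beta(g_{(-1)},a_{(-1)})[h\triangleleft a_{(0)},g_{(0)}]+h\triangleleft(g\triangleright a)-\beta(h_{(-1)},g_{(-1)})\,g_{(0)}\triangleleft(h_{(0)}\triangleright a)$. Double cross sum $\mathcal{A}\bowtie\mathcal{H}$ of a matched pair of $(H,\beta)$-Lie algebras: the $H$-comodule $\mathcal{A}\oplus\mathcal{H}$ with bracket $$[a\oplus h,b\oplus g]=\bigl([a,b]+h\triangleright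 b-\beta(a_{(-1)},g_{(-1)})\,g_{(0)}\triangleright a_{(0)}\bigr)\oplus\bigl([h,g]+h\triangleleft b-\beta(a_{(-1)},g_{(-1)})\,g_{(0)}\triangleleft a_{(0)}\bigr).$$ For $\mathcal{A}^\sigma\bowtie\mathcal{H}^\sigma$ this is used with $\beta_\sigma$, the twisted brackets and the twisted actions. Cocycle twists: for an $(H,\beta)$-Lie algebra $\mathcal{L}$, $\mathcal{L}^\sigma$ is the same $H$-comodule with bracket $[a,b]^\sigma=\sigma(a_{(-1)},b_{(-1)})[a_{(0)},b_{(0)}]$; it is an $(H,\beta_\sigma)$-Lie algebra. The twisted actions are $h\triangleright^\sigma a=\sigma(h_{(-1)},a_{(-1)})\,h_{(0)}\triangleright a_{(0)}$ and $h\triangleleft^\sigma a=\sigma(h_{(-1)},a_{(-1)})\,h_{(0)}\triangleleft a_{(0)}$ for $h\in\mathcal{H}$, $a\in\mathcal{A}$. *)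

(* Defs.v *)
From HB Require Import structures.
From mathcomp Require Import all_boot all_algebra.
From mathcomp Require Import boolp.

Set Implicit Arguments.
Unset Strict Implicit.
Unset Printing Implicit Defensive.

Import GRing.Theory.
Local Open Scope ring_scope.
Local Open Scope quotient_scope.

Definition bilinear_map (k : fieldType) (U V W : lmodType k)
    (f : U -> V -> W) : Prop :=
  (forall v, linear (f^~ v)) /\ (forall u, linear (f u)).

Definition bilinear_form (k : fieldType) (U V : lmodType k)
    (f : U -> V -> k) : Prop :=
  (forall v, scalar (f^~ v)) /\ (forall u, scalar (f u)).

(* The tensor product of V and W is the quotient of the finite formal sums    *)
(* of pairs (v, w) by the largest relation compatible with every bilinear     *)
(* map; [tlift], [tlift_linear], [tlift_pure] and [sum_sweedler] below give   *)
(* its universal property.                                                    *)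
Section TensorType.
Variables (k : fieldType) (V W : lmodType k).

Definition tensor_eq (s t : seq (V * W)) : Prop :=
  forall (U : lmodType k) (f : V -> W -> U), bilinear_map f ->
    \sum_(p <- s) f p.1 p.2 = \sum_(p <- t) f p.1 p.2.

Definition tensor_eqb : rel (seq (V * W)) := fun s t => `[< tensor_eq s t >].

Lemma tensor_eqb_refl : reflexive tensor_eqb.
Proof. by move=> s; apply/asboolP. Qed.

Lemma tensor_eqb_sym : symmetric tensor_eqb.
Proof. by move=> s t; apply/asboolP/asboolP => st U f fP; rewrite st. Qed.

Lemma tensor_eqb_trans : transitive tensor_eqb.
Proof.
move=> t s u /asboolP st /asboolP tu; apply/asboolP => U f fP.
by rewrite st // tu.
Qed.

Canonical tensor_equiv :=
  EquivRel tensor_eqb tensor_eqb_refl tensor_eqb_sym tensor_eqb_trans.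

Definition tensor : Type := {eq_quot tensor_equiv}.

HB.instance Definition _ := Choice.on tensor.
HB.instance Definition _ := Quotient.on tensor.
HB.instance Definition _ := EqQuotient.on tensor.

Definition pure (v : V) (w : W) : tensor := \pi_tensor [:: (v, w)].

(* A chosen expression t = sum_i v_i (x) w_i. Sweedler notation is read as    *)
(* summation over this sequence: when f is bilinear, the value of             *)
(* \sum_(p <- sweedler t) f p.1 p.2 does not depend on the choice.            *)
Definition sweedler (t : tensor) : seq (V * W) := repr t.

Definition tlift (U : lmodType k) (f : V -> W -> U) (t : tensor) : U :=
  \sum_(p <- sweedler t) f p.1 p.2.

Lemma tensor_piP (s t : seq (V * W)) :
  \pi_tensor s = \pi_tensor t <-> tensor_eq s t.
Proof.
split=> [/eqP | st]; first by rewrite piE => /asboolP.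
by apply/eqP; rewrite piE; apply/asboolP.
Qed.

Lemma tlift_pi (U : lmodType k) (f : V -> W -> U) (s : seq (V * W)) :
  bilinear_map f -> tlift f (\pi_tensor s) = \sum_(p <- s) f p.1 p.2.
Proof.
move=> fP; have /tensor_piP e : \pi_tensor (repr (\pi_tensor s)) = \pi_tensor s.
  exact: reprK.
exact: e.
Qed.

Lemma tlift_pure (U : lmodType k) (f : V -> W -> U) (v : V) (w : W) :
  bilinear_map f -> tlift f (pure v w) = f v w.
Proof. by move=> fP; rewrite tlift_pi // big_seq1. Qed.

Lemma tlift_ext (t u : tensor) :
  (forall (U : lmodType k) (f : V -> W -> U), bilinear_map f ->
    tlift f t = tlift f u) -> t = u.
Proof. by move=> tu; rewrite -[t]reprK -[u]reprK; apply/tensor_piP. Qed.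

Definition tensor_zero : tensor := \pi_tensor [::].
Definition tensor_add (t u : tensor) : tensor :=
  \pi_tensor (sweedler t ++ sweedler u).
Definition tensor_scale (c : k) (t : tensor) : tensor :=
  \pi_tensor [seq (c *: p.1, p.2) | p <- sweedler t].
Definition tensor_opp (t : tensor) : tensor := tensor_scale (-1) t.

Section TliftOps.
Variables (U : lmodType k) (f : V -> W -> U).
Hypothesis fP : bilinear_map f.

Lemma tlift_zero : tlift f tensor_zero = 0.
Proof. by rewrite tlift_pi // big_nil. Qed.

Lemma tlift_add t u : tlift f (tensor_add t u) = tlift f t + tlift f u.
Proof. by rewrite tlift_pi // big_cat. Qed.

Lemma tlift_scale c t : tlift f (tensor_scale c t) = c *: tlift f t.
Proof.
have f0 w : f 0 w = 0.
  by move: (fP.1 w (-1) 0 0); rewrite /= scaleN1r oppr0 addr0 scaleN1r addNr.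
rewrite tlift_pi // big_map scaler_sumr; apply: eq_bigr => p _ /=.
by move: (fP.1 p.2 c p.1 0); rewrite /= !addr0 f0 addr0.
Qed.

Lemma tlift_opp t : tlift f (tensor_opp t) = - tlift f t.
Proof. by rewrite tlift_scale scaleN1r. Qed.

End TliftOps.

Lemma tensor_addA : associative tensor_add.
Proof. by move=> t u v; apply: tlift_ext => U f fP; rewrite !tlift_add ?addrA. Qed.

Lemma tensor_addC : commutative tensor_add.
Proof. by move=> t u; apply: tlift_ext => U f fP; rewrite !tlift_add // addrC. Qed.

Lemma tensor_add0 : left_id tensor_zero tensor_add.
Proof.
by move=> t; apply: tlift_ext => U f fP; rewrite tlift_add // tlift_zero // add0r.
Qed.

Lemma tensor_addN : left_inverse tensor_zero tensor_opp tensor_add.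
Proof.
move=> t; apply: tlift_ext => U f fP.
by rewrite tlift_add // tlift_opp // tlift_zero // addNr.
Qed.

HB.instance Definition _ := GRing.isZmodule.Build tensor
  tensor_addA tensor_addC tensor_add0 tensor_addN.

Lemma tensor_scaleA a b t :
  tensor_scale a (tensor_scale b t) = tensor_scale (a * b) t.
Proof. by apply: tlift_ext => U f fP; rewrite !tlift_scale // scalerA. Qed.

Lemma tensor_scale1 : left_id 1 tensor_scale.
Proof. by move=> t; apply: tlift_ext => U f fP; rewrite tlift_scale // scale1r. Qed.

Lemma tensor_scaleDr : right_distributive tensor_scale +%R.
Proof.
move=> a t u; apply: tlift_ext => U f fP.
by rewrite tlift_scale // !tlift_add // !tlift_scale // scalerDr.
Qed.

Lemma tensor_scaleDl t : {morph tensor_scale^~ t : a b / a + b}.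
Proof.
move=> a b; apply: tlift_ext => U f fP.
by rewrite tlift_add // !tlift_scale // scalerDl.
Qed.

HB.instance Definition _ := GRing.Zmodule_isLmodule.Build k tensor
  tensor_scaleA tensor_scale1 tensor_scaleDr tensor_scaleDl.

Lemma tlift_linear (U : lmodType k) (f : V -> W -> U) :
  bilinear_map f -> linear (tlift f).
Proof. by move=> fP c t u; rewrite tlift_add // tlift_scale. Qed.

Lemma pure_bilinear : bilinear_map pure.
Proof.
split=> [w c x y|v c x y]; apply: tlift_ext => U f fP;
  rewrite tlift_linear // !tlift_pure //; [exact: fP.1 | exact: fP.2].
Qed.

Lemma tlift_sum (U : lmodType k) (f : V -> W -> U) (I : Type) (r : seq I)
    (F : I -> tensor) :
  bilinear_map f -> tlift f (\sum_(i <- r) F i) = \sum_(i <- r) tlift f (F i).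
Proof.
move=> fP; apply: (big_morph (tlift f)); last exact: tlift_zero.
by move=> t u; exact: tlift_add.
Qed.

Lemma sum_sweedler (t : tensor) : \sum_(p <- sweedler t) pure p.1 p.2 = t.
Proof.
apply: tlift_ext => U f fP; rewrite tlift_sum //.
by apply: eq_bigr => p _; rewrite tlift_pure.
Qed.

End TensorType.

Notation "v ⊗ w" := (pure v w) (at level 40, left associativity) : ring_scope.

HB.mixin Record Algebra_isHopf (k : fieldType) H of GRing.Algebra k H := {
  comul : {linear H -> tensor H H};
  counit : {scalar H};
  antipode : {linear H -> H};
  comulA : forall h,
    \sum_(p <- sweedler (comul h)) \sum_(q <- sweedler (comul p.1))
      q.1 ⊗ (q.2 ⊗ p.2) =
    \sum_(p <- sweedler (comul h)) p.1 ⊗ comul p.2;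
  counitl : forall h, \sum_(p <- sweedler (comul h)) counit p.1 *: p.2 = h;
  counitr : forall h, \sum_(p <- sweedler (comul h)) counit p.2 *: p.1 = h;
  comulM : forall h g, comul (h * g) =
    \sum_(p <- sweedler (comul h)) \sum_(q <- sweedler (comul g))
      (p.1 * q.1) ⊗ (p.2 * q.2);
  comul1 : comul 1 = 1 ⊗ 1;
  counitM : forall h g, counit (h * g) = counit h * counit g;
  counit1 : counit 1 = 1;
  antipodel : forall h,
    \sum_(p <- sweedler (comul h)) antipode p.1 * p.2 = counit h *: 1;
  antipoder : forall h,
    \sum_(p <- sweedler (comul h)) p.1 * antipode p.2 = counit h *: 1
}.

#[short(type="hopfAlgType")]
HB.structure Definition HopfAlgebra (k : fieldType) :=
  {H of Algebra_isHopf k H & GRing.Algebra k H}.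

Definition delta (k : fieldType) (H : hopfAlgType k) (h : H) : seq (H * H) :=
  sweedler (comul h).

Definition delta3 (k : fieldType) (H : hopfAlgType k) (h : H) :
    seq (H * H * H) :=
  [seq (p.1, q.1, q.2) | p <- delta h, q <- delta p.2].

Definition cocommutative (k : fieldType) (H : hopfAlgType k) : Prop :=
  forall h : H, \sum_(p <- delta h) p.2 ⊗ p.1 = comul h.

HB.mixin Record Lmodule_isComodule (k : fieldType) (H : hopfAlgType k) V
    of GRing.Lmodule k V := {
  coact : {linear V -> tensor H V};
  coactA : forall v,
    \sum_(p <- sweedler (coact v)) \sum_(q <- delta p.1) q.1 ⊗ (q.2 ⊗ p.2) =
    \sum_(p <- sweedler (coact v)) p.1 ⊗ coact p.2;
  coact_counit : forall v,
    \sum_(p <- sweedler (coact v)) counit p.1 *: p.2 = v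
}.

#[short(type="comodType")]
HB.structure Definition Comodule (k : fieldType) (H : hopfAlgType k) :=
  {V of Lmodule_isComodule k H V & GRing.Lmodule k V}.


Definition rho (k : fieldType) (H : hopfAlgType k) (V : comodType H) (v : V) :
    seq (H * V) :=
  sweedler (coact v).

Section ProductComodule.
Variables (k : fieldType) (H : hopfAlgType k).

Lemma bilinear_sum (U V W : lmodType k) (I : Type) (r : seq I)
    (f : I -> U -> V -> W) :
  (forall i, bilinear_map (f i)) ->
  bilinear_map (fun u v => \sum_(i <- r) f i u v).
Proof.
move=> fP; split=> [v c x y|u c x y]; rewrite scaler_sumr -big_split /=;
  apply: eq_bigr => i _; [exact: (fP i).1 | exact: (fP i).2].
Qed.

Lemma pureDr_bilinear (U V W : lmodType k) (f : V -> W) :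
  linear f -> bilinear_map (fun (u : U) v => u ⊗ f v).
Proof.
move=> fP; split=> [v c x y|u c x y]; first exact: (pure_bilinear _ _).1.
by rewrite fP (pure_bilinear _ _).2.
Qed.

Definition pushr (V W : lmodType k) (f : V -> W) : tensor H V -> tensor H W :=
  tlift (fun h v => h ⊗ f v).

Lemma pushrE (V W : lmodType k) (f : V -> W) t :
  pushr f t = \sum_(p <- sweedler t) p.1 ⊗ f p.2.
Proof. by []. Qed.

Lemma pushr_linear (V W : lmodType k) (f : V -> W) : linear f -> linear (pushr f).
Proof. by move=> fP; apply/tlift_linear/pureDr_bilinear. Qed.

Lemma coassoc_bilinear (V : lmodType k) :
  bilinear_map (fun (h : H) (v : V) => \sum_(q <- delta h) q.1 ⊗ (q.2 ⊗ v)).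
Proof.
split=> [v c x y|h c x y].
  have bP : bilinear_map (fun h g : H => h ⊗ (g ⊗ v)).
    by apply: pureDr_bilinear; exact: (pure_bilinear _ _).1.
  rewrite /delta linearP; exact: (tlift_linear bP).
rewrite scaler_sumr -big_split; apply: eq_bigr => q _ /=.
by rewrite (pure_bilinear _ _).2 (pure_bilinear _ _).2.
Qed.

Lemma coassoc_push (V : comodType H) (W : lmodType k) (f : V -> W)
    (D : W -> tensor H W) (v : V) :
  linear f -> linear D -> (forall a, D (f a) = pushr f (coact a)) ->
  tlift (fun h w => \sum_(q <- delta h) q.1 ⊗ (q.2 ⊗ w)) (pushr f (coact v)) =
  tlift (fun h w => h ⊗ D w) (pushr f (coact v)).
Proof.
move=> fP DP Df; have fB U := @pureDr_bilinear U _ _ _ fP.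
have gB := @pureDr_bilinear H _ _ _ (pushr_linear fP).
rewrite (pushrE f (coact v)) !tlift_sum; [|exact: pureDr_bilinear|exact: coassoc_bilinear].
transitivity (tlift (fun h u => h ⊗ pushr f u)
  (\sum_(p <- sweedler (coact v)) \sum_(q <- delta p.1) q.1 ⊗ (q.2 ⊗ p.2))).
  rewrite tlift_sum //; apply: eq_bigr => p _.
  rewrite tlift_pure; last exact: coassoc_bilinear.
  rewrite tlift_sum //; apply: eq_bigr => q _.
  by rewrite tlift_pure // /pushr tlift_pure.
rewrite coactA tlift_sum //; apply: eq_bigr => p _.
by rewrite !tlift_pure ?Df //; exact: pureDr_bilinear.
Qed.

Variables A L : comodType H.

Definition dsum_inl (a : A) : (A * L)%type := (a, 0).
Definition dsum_inr (l : L) : (A * L)%type := (0, l).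

Lemma dsum_inl_linear : linear dsum_inl.
Proof. by move=> c x y; congr pair; rewrite /= ?scaler0 ?addr0. Qed.

Lemma dsum_inr_linear : linear dsum_inr.
Proof. by move=> c x y; congr pair; rewrite /= ?scaler0 ?addr0. Qed.

(* rho (a, l) = a_(-1) (x) (a_(0), 0) + l_(-1) (x) (0, l_(0)) *)
Definition coact_prod (x : A * L) : tensor H (A * L)%type :=
  \sum_(p <- rho x.1) p.1 ⊗ (p.2, 0) + \sum_(p <- rho x.2) p.1 ⊗ (0, p.2).

Lemma coact_prodE x :
  coact_prod x = pushr dsum_inl (coact x.1) + pushr dsum_inr (coact x.2).
Proof. by []. Qed.

Lemma coact_prod_linear : linear coact_prod.
Proof.
move=> c x y; rewrite !coact_prodE /= !linearP.
rewrite (pushr_linear dsum_inl_linear) (pushr_linear dsum_inr_linear).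
by rewrite scalerDr addrACA.
Qed.

HB.instance Definition _ :=
  GRing.isLinear.Build k (A * L)%type (tensor H (A * L)%type) *:%R coact_prod
    coact_prod_linear.

Lemma pushr0 (V W : lmodType k) (f : V -> W) : linear f -> pushr f 0 = 0.
Proof. by move=> fP; apply/tlift_zero/pureDr_bilinear. Qed.

Lemma coact_prodA (x : A * L) :
  \sum_(p <- sweedler (coact_prod x)) \sum_(q <- delta p.1)
    q.1 ⊗ (q.2 ⊗ p.2) =
  \sum_(p <- sweedler (coact_prod x)) p.1 ⊗ coact_prod p.2.
Proof.
have DB := @pureDr_bilinear H _ _ _ coact_prod_linear.
rewrite -[LHS]/(tlift (fun h w => \sum_(q <- delta h) q.1 ⊗ (q.2 ⊗ w)) _).
rewrite -[RHS]/(tlift (fun h w => h ⊗ coact_prod w) _) coact_prodE.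
rewrite [LHS]tlift_add; last exact: coassoc_bilinear.
rewrite [RHS]tlift_add //; congr (_ + _); apply: coassoc_push.
- exact: dsum_inl_linear.
- exact: coact_prod_linear.
- by move=> a; rewrite coact_prodE /= linear0 pushr0 ?addr0 //; exact: dsum_inr_linear.
- exact: dsum_inr_linear.
- exact: coact_prod_linear.
- by move=> a; rewrite coact_prodE /= linear0 pushr0 ?add0r //; exact: dsum_inl_linear.
Qed.

Lemma coact_prod_counit (x : A * L) :
  \sum_(p <- sweedler (coact_prod x)) counit p.1 *: p.2 = x.
Proof.
have B (V : lmodType k) : bilinear_map (fun (h : H) (v : V) => counit h *: v).
  split=> [v c y z|h c y z].
    by rewrite linearP /= scalerDl scalerA.
  by rewrite scalerDr !scalerA mulrC.
rewrite -[LHS]/(tlift (fun h w => counit h *: w) _) coact_prodE.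
rewrite tlift_add // !pushrE !tlift_sum //.
rewrite -[RHS](_ : dsum_inl x.1 + dsum_inr x.2 = x); last first.
  by case: x => a l; congr pair; rewrite /= ?addr0 ?add0r.
congr (_ + _).
  rewrite -[in RHS](coact_counit x.1).
  rewrite (big_morph dsum_inl (id1 := 0) (op1 := +%R)) //; last first.
    by move=> u v; rewrite -[u]scale1r dsum_inl_linear !scale1r.
  apply: eq_bigr => p _; rewrite tlift_pure //.
  by congr pair; rewrite /= ?scaler0.
rewrite -[in RHS](coact_counit x.2).
rewrite (big_morph dsum_inr (id1 := 0) (op1 := +%R)) //; last first.
  by move=> u v; rewrite -[u]scale1r dsum_inr_linear !scale1r.
apply: eq_bigr => p _; rewrite tlift_pure //.
by congr pair; rewrite /= ?scaler0.
Qed.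

HB.instance Definition _ :=
  Lmodule_isComodule.Build k H (A * L)%type coact_prodA coact_prod_counit.

End ProductComodule.

Section Forms.
Variables (k : fieldType) (H : hopfAlgType k).
Implicit Types s t beta sigma : H -> H -> k.

Definition convolution s t (h g : H) : k :=
  \sum_(x <- delta h) \sum_(y <- delta g) s x.1 y.1 * t x.2 y.2.

Definition convolution_inverse s t : Prop :=
  [/\ bilinear_form t,
      forall h g, convolution s t h g = counit h * counit g &
      forall h g, convolution t s h g = counit h * counit g].

Definition convolution_invertible s : Prop :=
  exists t, convolution_inverse s t.

(* The convolution inverse, which is unique when it exists (and a junk value  *)
(* otherwise).                                                                *)
Definition conv_inv s : H -> H -> k :=
  if pselect (convolution_invertible s) is left e then projT1 (cid e) else s.

Lemma conv_invP s :
  convolution_invertible s -> convolution_inverse s (conv_inv s).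
Proof.
by rewrite /conv_inv => e; case: pselect => // e'; exact: projT2 (cid e').
Qed.

Record cotriangular beta : Prop := {
  cotriangular_bilinear : bilinear_form beta;
  cotriangular_invertible : convolution_invertible beta;
  cotriangular1 : forall h g : H,
    \sum_(x <- delta h) \sum_(y <- delta g) beta x.1 y.1 *: (y.2 * x.2) =
    \sum_(x <- delta h) \sum_(y <- delta g) beta x.2 y.2 *: (x.1 * y.1);
  cotriangular2 : forall h g l : H,
    beta h (g * l) = \sum_(x <- delta h) beta x.1 g * beta x.2 l;
  cotriangular3 : forall h g l : H,
    beta (h * g) l = \sum_(z <- delta l) beta g z.1 * beta h z.2;
  cotriangular4 : forall h g : H,
    \sum_(x <- delta h) \sum_(y <- delta g) beta x.1 y.1 * beta y.2 x.2 =
    counit g * counit h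
}.

Record left_cocycle sigma : Prop := {
  left_cocycle_bilinear : bilinear_form sigma;
  left_cocycle_invertible : convolution_invertible sigma;
  left_cocycleE : forall h g l : H,
    \sum_(x <- delta h) \sum_(y <- delta g)
      sigma x.1 y.1 * sigma (x.2 * y.2) l =
    \sum_(y <- delta g) \sum_(z <- delta l)
      sigma y.1 z.1 * sigma h (y.2 * z.2)
}.

(* beta_sigma(h, l) = sigma^-1(l_1, h_1) beta(h_2, l_2) sigma(h_3, l_3) *)
Definition twist_form sigma beta (h l : H) : k :=
  \sum_(x <- delta3 h) \sum_(y <- delta3 l)
    conv_inv sigma y.1.1 x.1.1 * beta x.1.2 y.1.2 * sigma x.2 y.2.

End Forms.

Section LieAlgebras.
Variables (k : fieldType) (H : hopfAlgType k).
Implicit Types beta sigma : H -> H -> k.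

(* H-comodule morphisms U (x) V -> W, presented as bilinear maps on U x V *)
Definition comodule_bimap (U V W : comodType H) (f : U -> V -> W) : Prop :=
  bilinear_map f /\
  forall u v, coact (f u v) =
    \sum_(x <- rho u) \sum_(y <- rho v) (x.1 * y.1) ⊗ f x.2 y.2.

Record lie_algebra beta (L : comodType H) (br : L -> L -> L) : Prop := {
  lie_comodule_bimap : comodule_bimap br;
  lie_antisym : forall a b, br a b =
    - (\sum_(x <- rho a) \sum_(y <- rho b) beta x.1 y.1 *: br y.2 x.2);
  lie_jacobi : forall a b c,
    br (br a b) c +
    \sum_(x <- rho a) \sum_(y <- rho b) \sum_(z <- rho c)
      beta x.1 (y.1 * z.1) *: br (br y.2 z.2) x.2 +
    \sum_(x <- rho a) \sum_(y <- rho b) \sum_(z <- rho c)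
      beta (x.1 * y.1) z.1 *: br (br z.2 x.2) y.2 = 0
}.

Definition left_lie_module beta (L A : comodType H) (br : L -> L -> L)
    (act : L -> A -> A) : Prop :=
  comodule_bimap act /\
  forall h g a, act (br h g) a = act h (act g a) -
    \sum_(x <- rho h) \sum_(y <- rho g) beta x.1 y.1 *: act y.2 (act x.2 a).

Definition right_lie_module beta (A L : comodType H) (br : A -> A -> A)
    (act : L -> A -> L) : Prop :=
  comodule_bimap act /\
  forall h a b, act h (br a b) = act (act h a) b -
    \sum_(x <- rho a) \sum_(y <- rho b) beta x.1 y.1 *: act (act h y.2) x.2.

Record matched_pair beta (A L : comodType H)
    (brA : A -> A -> A) (brL : L -> L -> L)
    (lact : L -> A -> A) (ract : L -> A -> L) : Prop := {
  matched_pair_lieA : lie_algebra beta brA;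
  matched_pair_lieL : lie_algebra beta brL;
  matched_pair_left : left_lie_module beta brL lact;
  matched_pair_right : right_lie_module beta brA ract;
  matched_pair_BB1 : forall (h : L) (a b : A),
    lact h (brA a b) =
      brA (lact h a) b +
      \sum_(x <- rho h) \sum_(y <- rho a)
        beta x.1 y.1 *: brA y.2 (lact x.2 b) +
      lact (ract h a) b -
      \sum_(x <- rho a) \sum_(y <- rho b)
        beta x.1 y.1 *: lact (ract h y.2) x.2;
  matched_pair_BB2 : forall (h g : L) (a : A),
    ract (brL h g) a =
      brL h (ract g a) +
      \sum_(x <- rho g) \sum_(y <- rho a)
        beta x.1 y.1 *: brL (ract h y.2) x.2 +
      ract h (lact g a) -
      \sum_(x <- rho h) \sum_(y <- rho g)
        beta x.1 y.1 *: ract y.2 (lact x.2 a)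
}.

Definition twist sigma (U V W : comodType H) (f : U -> V -> W) (u : U) (v : V)
    : W :=
  \sum_(x <- rho u) \sum_(y <- rho v) sigma x.1 y.1 *: f x.2 y.2.

Definition double_cross_sum beta (A L : comodType H)
    (brA : A -> A -> A) (brL : L -> L -> L)
    (lact : L -> A -> A) (ract : L -> A -> L) (u v : A * L) : A * L :=
  (brA u.1 v.1 + lact u.2 v.1 -
     \sum_(x <- rho u.1) \sum_(y <- rho v.2) beta x.1 y.1 *: lact y.2 x.2,
   brL u.2 v.2 + ract u.2 v.1 -
     \sum_(x <- rho u.1) \sum_(y <- rho v.2) beta x.1 y.1 *: ract y.2 x.2).

End LieAlgebras.

(* Main.v *)
From HB Require Import structures.
From mathcomp Require Import boolp.
Require Import Defs.
From mathcomp Require Import all_boot all_algebra.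
Set Implicit Arguments.
Unset Strict Implicit.
Unset Printing Implicit Defensive.
Import GRing.Theory.
Local Open Scope ring_scope.

(** Two families of bilinear data on comodules carry the whole statement:
    brackets and actions on one side, forms such as the cotriangular structure
    and the cocycle on the other. A form on H (x) H acts on a bilinear map F by
      (s F)(u, v) = s(u_(-1), v_(-1)) F(u_(0), v_(0)),
    and a form on H (x) H (x) H acts likewise on trilinear maps. These are
    actions of convolution algebras ([act2_act2], [act3_act3]), which are
    commutative because H is cocommutative. Every sum in the definitions of a
    braided Lie algebra, of its modules and of a matched pair is such an action
    composed with a permutation of the arguments, so each identity to be proved
    reduces to an identity in one of two commutative monoids of forms.

    A product of two twisted operations, nested to the left or to the right, is
    the form
      sigma3(h, g, l) = sigma(h_1, g_1) sigma(h_2 g_2, l)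
                      = sigma(g_1, l_1) sigma(h, g_2 l_2)
    acting on the product of the original operations ([twist_nestl],
    [twist_nestr]); both nestings give the same form precisely because sigma is
    a cocycle. When the arguments are permuted, sigma3 is permuted as well, and
    the braiding by the twisted form exactly undoes this: braiding by beta_sigma
    after acting by sigma3 equals acting by sigma3 after braiding by beta
    ([twist_braid12], [twist_braid23], [twist_braid1_23], [twist_braid12_3]).
    Hence every twisted axiom is sigma3 acting on the original axiom, which
    gives [twist_lie] and [twist_matched_pair].

    The double cross sum D of the original matched pair is a Lie algebra over
    (H, beta) ([double_cross_sum_lie]). Granted antisymmetry,
    the Jacobi sum J(u, v, w) equals the Leibniz defect
      [[u, v], w] - [u, [v, w]] - beta(v_(-1), w_(-1)) [[u, w_(0)], v_(0)]
    ([jacobiator_leibniz]), and J is invariant under braided rotation of its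
    arguments ([jacobiator_rot]). It therefore suffices to evaluate the defect
    on (L, A, A), where its two components are the first compatibility condition
    and the right module axiom, and on (L, L, A), where they are the left module
    axiom and the second compatibility condition. Finally the twist of D is the
    double cross sum of the twisted data ([twist_double_cross_sum]), so that
    [twist_lie] applied to D finishes the proof. *)

(** The regular comodule: with it, convolution of forms is the special case
    U = V = W = H of the action of forms on multilinear maps, and associativity
    of convolution is the module axiom. *)
#[non_forgetful_inheritance]
HB.instance Definition _ (k : fieldType) (H : hopfAlgType k) :=
  Lmodule_isComodule.Build k H H (@comulA k H) (@counitl k H).

(** * Multilinear maps *)

Section Multilinear.
Variable k : fieldType.
Implicit Types U V W X Y : lmodType k.

Definition trilinear_map U V W X (f : U -> V -> W -> X) : Prop :=
  (forall v w, linear (fun u => f u v w)) /\ (forall u, bilinear_map (f u)).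

Lemma sum_linear U X (I : Type) (r : seq I) (f : I -> U -> X) :
  (forall i, linear (f i)) -> linear (fun u => \sum_(i <- r) f i u).
Proof.
move=> fP c x y; rewrite scaler_sumr -big_split /=.
by apply: eq_bigr => i _; exact: fP.
Qed.

Lemma linear_scalel U X (f : U -> k^o) (x : X) :
  linear f -> linear (fun u => f u *: x).
Proof. by move=> fP c u v; rewrite fP scalerDl scalerA. Qed.

Lemma linear_scaler U X (c : k) (f : U -> X) :
  linear f -> linear (fun u => c *: f u).
Proof. by move=> fP d u v; rewrite fP scalerDr !scalerA mulrC. Qed.

Lemma linear_comp U V X (f : U -> V) (g : V -> X) :
  linear f -> linear g -> linear (fun u => g (f u)).
Proof. by move=> fP gP c u v; rewrite fP gP. Qed.

Lemma linear_map_sum U X (g : U -> X) (I : Type) (r : seq I) (f : I -> U) :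
  linear g -> g (\sum_(i <- r) f i) = \sum_(i <- r) g (f i).
Proof.
move=> gP; apply: (big_morph g) => [x y|].
  by rewrite -[x]scale1r gP !scale1r.
by move: (gP (-1) 0 0); rewrite scaler0 addr0 scaleN1r addNr.
Qed.

Lemma linear_mapZ U X (g : U -> X) c u : linear g -> g (c *: u) = c *: g u.
Proof.
move=> gP; have g0 : g 0 = 0.
  by move: (gP (-1) 0 0); rewrite scaler0 addr0 scaleN1r addNr.
by rewrite -[c *: u]addr0 gP g0 addr0.
Qed.

Section Trilinear.
Variables (U V W X : lmodType k) (F : U -> V -> W -> X).
Hypothesis FP : trilinear_map F.

Lemma trilinear_swap12 : trilinear_map (fun v u w => F u v w).
Proof.
split=> [u w|v]; first exact: (FP.2 u).1.
by split=> [w|u]; [exact: FP.1|exact: (FP.2 u).2].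
Qed.

Lemma trilinear_swap23 : trilinear_map (fun u w v => F u v w).
Proof.
by split=> [w v|u]; [exact: FP.1|split; [exact: (FP.2 u).2|exact: (FP.2 u).1]].
Qed.

End Trilinear.

Lemma trilinear_rotl U V W X (F : U -> V -> W -> X) :
  trilinear_map F -> trilinear_map (fun w u v => F u v w).
Proof. by move/trilinear_swap23/trilinear_swap12. Qed.

Lemma trilinear_rotr U V W X (F : U -> V -> W -> X) :
  trilinear_map F -> trilinear_map (fun v w u => F u v w).
Proof. by move/trilinear_swap12/trilinear_swap23. Qed.

Lemma trilinear_nestl U V W X Y (f : U -> V -> X) (g : X -> W -> Y) :
  bilinear_map f -> bilinear_map g -> trilinear_map (fun u v w => g (f u v) w).
Proof.
move=> fP gP; split=> [v w|u]; last split=> [w|v].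
- by apply: linear_comp (gP.1 w); exact: fP.1.
- by apply: linear_comp (gP.1 w); exact: fP.2.
- exact: gP.2.
Qed.

Lemma trilinear_nestr U V W X Y (f : V -> W -> X) (g : U -> X -> Y) :
  bilinear_map f -> bilinear_map g -> trilinear_map (fun u v w => g u (f v w)).
Proof.
move=> fP gP; split=> [v w|u]; first exact: gP.1.
split=> [w|v]; first by apply: linear_comp (gP.2 u); exact: fP.1.
by apply: linear_comp (gP.2 u); exact: fP.2.
Qed.

Lemma bilinear_flip U V X (f : U -> V -> X) :
  bilinear_map f -> bilinear_map (fun v u => f u v).
Proof. by case. Qed.

End Multilinear.

(** * Sweedler sums *)

Section Sweedler.
Variables (k : fieldType) (H : hopfAlgType k).
Implicit Types (U V W : comodType H) (X Y : lmodType k).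

Lemma linear_rho V X (f : H -> V -> X) :
  bilinear_map f -> linear (fun v => \sum_(x <- rho v) f x.1 x.2).
Proof.
move=> fP c u v.
rewrite -[LHS]/(tlift f (coact (c *: u + v))) linearP.
exact: (tlift_linear fP).
Qed.

(** Both sides are the value of one linear map on the two sides of the
    coassociativity axiom, which lives in H (x) (H (x) V). *)
Lemma rho_coassoc V X (T : H -> H -> V -> X) v :
  trilinear_map T ->
  \sum_(x <- rho v) \sum_(y <- rho x.2) T x.1 y.1 y.2 =
  \sum_(x <- rho v) \sum_(q <- delta x.1) T q.1 q.2 x.2.
Proof.
move=> TP; pose G h (t : tensor H V) : X := tlift (T h) t.
have GP : bilinear_map G.
  split=> [t|h]; last by apply: tlift_linear; exact: TP.2.
  by apply: sum_linear => p; exact: TP.1.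
transitivity (tlift G (\sum_(p <- rho v) p.1 ⊗ coact p.2)).
  by rewrite tlift_sum //; apply: eq_bigr => p _; rewrite tlift_pure.
rewrite /rho -coactA tlift_sum //; apply: eq_bigr => p _.
rewrite tlift_sum //; apply: eq_bigr => q _.
by rewrite tlift_pure // /G tlift_pure //; exact: TP.2.
Qed.

Lemma delta_swap X (f : H -> H -> X) h :
  cocommutative H -> bilinear_map f ->
  \sum_(q <- delta h) f q.1 q.2 = \sum_(q <- delta h) f q.2 q.1.
Proof.
move=> cc fP; rewrite -[LHS]/(tlift f (comul h)) -cc tlift_sum //.
by apply: eq_bigr => p _; rewrite tlift_pure.
Qed.

(** For a cocommutative H the legs v_(-2) and v_(-1) are interchangeable; all
    commutativity below comes from this. *)
Lemma rho_swap V X (T : H -> H -> V -> X) v :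
  cocommutative H -> trilinear_map T ->
  \sum_(x <- rho v) \sum_(y <- rho x.2) T x.1 y.1 y.2 =
  \sum_(x <- rho v) \sum_(y <- rho x.2) T y.1 x.1 y.2.
Proof.
move=> cc TP; rewrite rho_coassoc // [RHS](rho_coassoc (T := fun h g => T g h)).
  apply: eq_bigr => x _.
  apply: (delta_swap (f := fun h g => T h g x.2)) => //.
  by split=> [g|h]; [exact: TP.1|exact: (TP.2 h).1].
exact: trilinear_swap12.
Qed.

Lemma rho_bimap U V W X (f : U -> V -> W) (g : H -> W -> X) u v :
  comodule_bimap f -> bilinear_map g ->
  \sum_(z <- rho (f u v)) g z.1 z.2 =
  \sum_(x <- rho u) \sum_(y <- rho v) g (x.1 * y.1) (f x.2 y.2).
Proof.
move=> [_ fc] gP; rewrite -[LHS]/(tlift g (coact (f u v))) fc tlift_sum //.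
apply: eq_bigr => x _; rewrite tlift_sum //.
by apply: eq_bigr => y _; rewrite tlift_pure.
Qed.

Lemma mul_bimap : comodule_bimap (fun h g : H => h * g).
Proof.
split; last exact: comulM.
by split=> [v|u] c x y /=; rewrite ?mulrDl ?mulrDr -?scalerAl -?scalerAr.
Qed.

(** * Actions of forms on multilinear maps *)

(** The actions are defined one variable at a time, each from the previous one,
    so that the module axiom and commutativity can be lifted from n variables
    to n + 1 by a single use of coassociativity or cocommutativity. *)
Definition act1 V X (s : H -> k) (F : V -> X) (v : V) : X :=
  \sum_(y <- rho v) s y.1 *: F y.2.

Definition act2 U V X (s : H -> H -> k) (F : U -> V -> X) u v : X :=
  \sum_(x <- rho u) act1 (s x.1) (F x.2) v.

Definition act3 U V W X (p : H -> H -> H -> k) (F : U -> V -> W -> X)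
    u v w : X :=
  \sum_(x <- rho u) act2 (p x.1) (F x.2) v w.

Lemma act1_linl V X Y (s : Y -> H -> k^o) (F : V -> X) v :
  (forall h, linear (fun a => s a h)) -> linear (fun a => act1 (s a) F v).
Proof. by move=> sP; apply: sum_linear => y; exact: linear_scalel. Qed.

Lemma act1_linr V X Y (s : H -> k) (F : Y -> V -> X) v :
  (forall x, linear (fun a => F a x)) -> linear (fun a => act1 s (F a) v).
Proof. by move=> FP; apply: sum_linear => y; exact: linear_scaler. Qed.

Lemma act2_linl U V X Y (s : Y -> H -> H -> k^o) (F : U -> V -> X) u v :
  (forall h g, linear (fun a => s a h g)) -> linear (fun a => act2 (s a) F u v).
Proof. by move=> sP; apply: sum_linear => y; exact: act1_linl. Qed.

Lemma act2_linr U V X Y (s : H -> H -> k) (F : Y -> U -> V -> X) u v :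
  (forall x y, linear (fun a => F a x y)) -> linear (fun a => act2 s (F a) u v).
Proof. by move=> sP; apply: sum_linear => y; exact: act1_linr. Qed.

Lemma scale_bilinear X Y Y' (s : Y -> k^o) (F : Y' -> X) :
  linear s -> linear F -> bilinear_map (fun h v => s h *: F v).
Proof.
by move=> sP FP; split=> [v|h]; [exact: linear_scalel|exact: linear_scaler].
Qed.

Lemma act1_linear V X (s : H -> k^o) (F : V -> X) :
  linear s -> linear F -> linear (act1 s F).
Proof.
move=> sP FP; apply: (linear_rho (f := fun h v => s h *: F v)).
exact: scale_bilinear.
Qed.

Lemma act2_bilinear U V X (s : H -> H -> k^o) (F : U -> V -> X) :
  bilinear_map s -> bilinear_map F -> bilinear_map (act2 s F).
Proof.
move=> sP FP; split=> [v|u].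
  apply: (linear_rho (f := fun h u => act1 (s h) (F u) v)).
  split=> [u|h]; first by apply: act1_linl; exact: sP.1.
  by apply: act1_linr; exact: FP.1.
by apply: sum_linear => x; apply: act1_linear; [exact: sP.2|exact: FP.2].
Qed.

Lemma act3_trilinear U V W X (p : H -> H -> H -> k^o) (F : U -> V -> W -> X) :
  trilinear_map p -> trilinear_map F -> trilinear_map (act3 p F).
Proof.
move=> pP FP; split=> [v w|u].
  apply: (linear_rho (f := fun h u => act2 (p h) (F u) v w)).
  split=> [u|h]; first by apply: act2_linl; exact: pP.1.
  by apply: act2_linr; exact: FP.1.
by apply: bilinear_sum => x; apply: act2_bilinear; [exact: pP.2|exact: FP.2].
Qed.

Lemma act1_sumr V X (I : Type) (r : seq I) (s : H -> k) (F : I -> V -> X) v :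
  act1 s (fun v => \sum_(i <- r) F i v) v = \sum_(i <- r) act1 s (F i) v.
Proof.
by rewrite exchange_big; apply: eq_bigr => y _; rewrite scaler_sumr.
Qed.

Lemma act1_suml V X (I : Type) (r : seq I) (s : I -> H -> k) (F : V -> X) v :
  act1 (fun h => \sum_(i <- r) s i h) F v = \sum_(i <- r) act1 (s i) F v.
Proof.
by rewrite exchange_big; apply: eq_bigr => y _; rewrite scaler_suml.
Qed.

Lemma act2_sumr U V X (I : Type) (r : seq I) (s : H -> H -> k)
    (F : I -> U -> V -> X) u v :
  act2 s (fun u v => \sum_(i <- r) F i u v) u v =
  \sum_(i <- r) act2 s (F i) u v.
Proof.
by rewrite exchange_big; apply: eq_bigr => y _; rewrite act1_sumr.
Qed.

Lemma act2_suml U V X (I : Type) (r : seq I) (s : I -> H -> H -> k)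
    (F : U -> V -> X) u v :
  act2 (fun h g => \sum_(i <- r) s i h g) F u v =
  \sum_(i <- r) act2 (s i) F u v.
Proof.
by rewrite exchange_big; apply: eq_bigr => y _; rewrite act1_suml.
Qed.

Lemma act1_act1 V X (s t : H -> k^o) (F : V -> X) v :
  linear s -> linear t -> linear F ->
  act1 s (act1 t F) v = act1 (act1 s t) F v.
Proof.
move=> sP tP FP; rewrite /act1.
under eq_bigr do rewrite scaler_sumr.
rewrite (rho_coassoc (T := fun h g v => s h *: (t g *: F v))); last first.
  apply: (trilinear_nestr (g := fun h x => s h *: x)
    (f := fun h v => t h *: F v)).
    exact: scale_bilinear.
  exact: scale_bilinear.
apply: eq_bigr => x _; rewrite scaler_suml.
by apply: eq_bigr => y _; rewrite scalerA.
Qed.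

(** Coassociativity in u splits off the first variable; what remains is the
    one-variable statement for the partially evaluated forms. *)
Lemma act2_act2 U V X (s t : H -> H -> k^o) (F : U -> V -> X) u v :
  bilinear_map s -> bilinear_map t -> bilinear_map F ->
  act2 s (act2 t F) u v = act2 (act2 s t) F u v.
Proof.
move=> sP tP FP; transitivity (\sum_(x <- rho u) \sum_(x' <- rho x.2)
    act1 (act1 (s x.1) (t x'.1)) (F x'.2) v).
  apply: eq_bigr => x _; rewrite act1_sumr; apply: eq_bigr => x' _.
  by rewrite act1_act1 //; [exact: sP.2|exact: tP.2|exact: FP.2].
rewrite (rho_coassoc (T := fun h g u => act1 (act1 (s h) (t g)) (F u) v)).
  by apply: eq_bigr => x _; rewrite -act1_suml.
split=> [g x|h]; last split=> [x|g].
- by apply: act1_linl => l; apply: act1_linl; exact: sP.1.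
- by apply: act1_linl => l; apply: act1_linr; exact: tP.1.
- by apply: act1_linr; exact: FP.1.
Qed.

Lemma act3_act3 U V W X (p q : H -> H -> H -> k^o)
    (F : U -> V -> W -> X) u v w :
  trilinear_map p -> trilinear_map q -> trilinear_map F ->
  act3 p (act3 q F) u v w = act3 (act3 p q) F u v w.
Proof.
move=> pP qP FP.
transitivity (\sum_(x <- rho u) \sum_(x' <- rho x.2)
    act2 (act2 (p x.1) (q x'.1)) (F x'.2) v w).
  apply: eq_bigr => x _; rewrite act2_sumr; apply: eq_bigr => x' _.
  by rewrite act2_act2 //; [exact: pP.2|exact: qP.2|exact: FP.2].
rewrite (rho_coassoc (T := fun h g u => act2 (act2 (p h) (q g)) (F u) v w)).
  by apply: eq_bigr => x _; rewrite -act2_suml.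
split=> [g x|h]; last split=> [x|g].
- by apply: act2_linl => l l'; apply: act2_linl; exact: pP.1.
- by apply: act2_linl => l l'; apply: act2_linr; exact: qP.1.
- by apply: act2_linr; exact: FP.1.
Qed.

Hypothesis cc : cocommutative H.

Lemma act1C (s t : H -> k^o) h :
  linear s -> linear t -> act1 s t h = act1 t s h.
Proof.
move=> sP tP; rewrite -[LHS]/(\sum_(q <- delta h) (s q.1 *: t q.2)).
rewrite (delta_swap (f := fun h g => s h *: t g)) //; last first.
  exact: scale_bilinear.
by apply: eq_bigr => q _; exact: mulrC.
Qed.

Lemma act2C (s t : H -> H -> k^o) h g :
  bilinear_map s -> bilinear_map t -> act2 s t h g = act2 t s h g.
Proof.
move=> sP tP; rewrite -[LHS]/(\sum_(q <- delta h) act1 (s q.1) (t q.2) g).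
rewrite (delta_swap (f := fun h l => act1 (s h) (t l) g)) //.
  by apply: eq_bigr => q _; apply: act1C; [exact: sP.2|exact: tP.2].
by split=> [x|x]; [apply: act1_linl; exact: sP.1|apply: act1_linr; exact: tP.1].
Qed.

Lemma act3C (p q : H -> H -> H -> k^o) h g l :
  trilinear_map p -> trilinear_map q -> act3 p q h g l = act3 q p h g l.
Proof.
move=> pP qP; rewrite -[LHS]/(\sum_(x <- delta h) act2 (p x.1) (q x.2) g l).
rewrite (delta_swap (f := fun h h' => act2 (p h) (q h') g l)) //.
  by apply: eq_bigr => x _; apply: act2C; [exact: pP.2|exact: qP.2].
by split=> [x|x]; [apply: act2_linl; exact: pP.1|apply: act2_linr; exact: qP.1].
Qed.

End Sweedler.

(** * Permuting, nesting and forgetting arguments *)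

Section Reindex.
Variables (k : fieldType) (H : hopfAlgType k).
Implicit Types (U V W Z : comodType H) (X Y : lmodType k).

Lemma eq_act2 U V X (s : H -> H -> k) (F G : U -> V -> X) u v :
  (forall u v, F u v = G u v) -> act2 s F u v = act2 s G u v.
Proof.
by move=> FG; apply: eq_bigr => x _; apply: eq_bigr => y _; rewrite FG.
Qed.

Lemma eq_act3 U V W X (p : H -> H -> H -> k) (F G : U -> V -> W -> X) u v w :
  (forall u v w, F u v w = G u v w) -> act3 p F u v w = act3 p G u v w.
Proof. by move=> FG; apply: eq_bigr => x _; apply: eq_act2. Qed.

Lemma act2D U V X (s : H -> H -> k) (F G : U -> V -> X) u v :
  act2 s (fun u v => F u v + G u v) u v = act2 s F u v + act2 s G u v.
Proof.
rewrite /act2 /act1 -big_split; apply: eq_bigr => x _ /=.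
by rewrite -big_split; apply: eq_bigr => y _; rewrite /= scalerDr.
Qed.

Lemma act2N U V X (s : H -> H -> k) (F : U -> V -> X) u v :
  act2 s (fun u v => - F u v) u v = - act2 s F u v.
Proof.
rewrite /act2 /act1 -sumrN; apply: eq_bigr => x _ /=.
by rewrite -sumrN; apply: eq_bigr => y _; rewrite scalerN.
Qed.

Lemma act3D U V W X (p : H -> H -> H -> k) (F G : U -> V -> W -> X) u v w :
  act3 p (fun u v w => F u v w + G u v w) u v w =
  act3 p F u v w + act3 p G u v w.
Proof. by rewrite /act3 -big_split; apply: eq_bigr => x _; rewrite act2D. Qed.

Lemma act3N U V W X (p : H -> H -> H -> k) (F : U -> V -> W -> X) u v w :
  act3 p (fun u v w => - F u v w) u v w = - act3 p F u v w.
Proof. by rewrite /act3 -sumrN; apply: eq_bigr => x _; rewrite act2N. Qed.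

Lemma act3_0 U V W X (p : H -> H -> H -> k) (u : U) (v : V) (w : W) :
  act3 p (fun _ _ _ => 0 : X) u v w = 0.
Proof.
by rewrite /act3 /act2 /act1; do 3![apply: big1 => ? _]; rewrite scaler0.
Qed.

Lemma linear_act2 U V X Y (g : X -> Y) (s : H -> H -> k) (F : U -> V -> X) u v :
  linear g -> g (act2 s F u v) = act2 s (fun u v => g (F u v)) u v.
Proof.
move=> gP; rewrite linear_map_sum //; apply: eq_bigr => x _.
rewrite linear_map_sum //; apply: eq_bigr => y _; exact: linear_mapZ.
Qed.

Lemma linear_act3 U V W X Y (g : X -> Y) (p : H -> H -> H -> k)
    (F : U -> V -> W -> X) u v w :
  linear g -> g (act3 p F u v w) = act3 p (fun u v w => g (F u v w)) u v w.
Proof.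
move=> gP; rewrite linear_map_sum //; apply: eq_bigr => x _; exact: linear_act2.
Qed.

Lemma act2_flip U V X (s : H -> H -> k) (F : U -> V -> X) u v :
  act2 (fun h g => s g h) (fun v u => F u v) v u = act2 s F u v.
Proof. exact: exchange_big. Qed.

Lemma act3_swap12 U V W X (p : H -> H -> H -> k) (F : U -> V -> W -> X) u v w :
  act3 (fun g h l => p h g l) (fun v u w => F u v w) v u w = act3 p F u v w.
Proof. exact: exchange_big. Qed.

Lemma act3_swap23 U V W X (p : H -> H -> H -> k) (F : U -> V -> W -> X) u v w :
  act3 (fun h l g => p h g l) (fun u w v => F u v w) u w v = act3 p F u v w.
Proof. by apply: eq_bigr => x _; exact: exchange_big. Qed.

(** The coaction of f(u, v) is the product of the coactions of u and v, hence a
    form in f(u, v) and w becomes a form in three arguments, with h and g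
    multiplied. *)
Lemma act2_nestl U V W Z X (s : H -> H -> k^o) (f : U -> V -> Z)
    (F : Z -> W -> X) u v w :
  bilinear_map s -> comodule_bimap f -> bilinear_map F ->
  act2 s F (f u v) w =
  act3 (fun h g l => s (h * g) l) (fun u v w => F (f u v) w) u v w.
Proof.
move=> sP fP FP; rewrite /act2.
rewrite (rho_bimap (g := fun h z => act1 (s h) (F z) w)) //.
by split=> [z|h]; [apply: act1_linl; exact: sP.1|apply: act1_linr; exact: FP.1].
Qed.

Lemma act2_nestr U V W Z X (s : H -> H -> k^o) (f : V -> W -> Z)
    (F : U -> Z -> X) u v w :
  bilinear_map s -> comodule_bimap f -> bilinear_map F ->
  act2 s F u (f v w) =
  act3 (fun h g l => s h (g * l)) (fun u v w => F u (f v w)) u v w.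
Proof.
move=> sP fP FP; apply: eq_bigr => x _.
rewrite /act1 (rho_bimap (g := fun h z => s x.1 h *: F x.2 z)) //.
by apply: scale_bilinear; [exact: sP.2|exact: FP.2].
Qed.

Lemma act3_counit3 U V W X (s : H -> H -> k) (F : U -> V -> W -> X) u v w :
  trilinear_map F ->
  act3 (fun h g l => s h g * counit l) F u v w =
  act2 s (fun u v => F u v w) u v.
Proof.
move=> FP; apply: eq_bigr => x _; apply: eq_bigr => y _.
rewrite -[in RHS](coact_counit w) (linear_map_sum _ _ ((FP.2 _).2 _)).
rewrite scaler_sumr.
by apply: eq_bigr => z _; rewrite (linear_mapZ _ _ ((FP.2 _).2 _)) scalerA.
Qed.

Lemma act3_counit1 U V W X (s : H -> H -> k) (F : U -> V -> W -> X) u v w :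
  trilinear_map F ->
  act3 (fun h g l => counit h * s g l) F u v w = act2 s (F u) v w.
Proof.
move=> FP; have GP : linear (fun u => act2 s (F u) v w).
  by apply: act2_linr; exact: FP.1.
rewrite -[in RHS](coact_counit u) (linear_map_sum _ _ GP).
apply: eq_bigr => x _; rewrite (linear_mapZ _ _ GP).
rewrite /act2 /act1 scaler_sumr; apply: eq_bigr => y _.
by rewrite scaler_sumr; apply: eq_bigr => z _; rewrite scalerA.
Qed.

Lemma act2_counit U V X (F : U -> V -> X) u v :
  bilinear_map F -> act2 (fun h g => counit h * counit g) F u v = F u v.
Proof.
move=> FP; rewrite -[in RHS](coact_counit u) (linear_map_sum _ _ (FP.1 _)).
apply: eq_bigr => x _; rewrite (linear_mapZ _ _ (FP.1 _)).
rewrite -[in RHS](coact_counit v) (linear_map_sum _ _ (FP.2 _)) scaler_sumr.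
by apply: eq_bigr => y _; rewrite (linear_mapZ _ _ (FP.2 _)) scalerA.
Qed.

Lemma act3_counit U V W X (F : U -> V -> W -> X) u v w :
  trilinear_map F ->
  act3 (fun h g l => counit h * (counit g * counit l)) F u v w = F u v w.
Proof.
move=> FP; rewrite (act3_counit1 (fun g l => counit g * counit l)) //.
by apply: act2_counit; exact: FP.2.
Qed.

End Reindex.

(** * The convolution monoids of forms *)

Section Forms.
Variables (k : fieldType) (H : hopfAlgType k).

Record form2 := Form2 {
  form2_fun :> H -> H -> k^o;
  form2P : bilinear_map form2_fun }.

Record form3 := Form3 {
  form3_fun :> H -> H -> H -> k^o;
  form3P : trilinear_map form3_fun }.

Lemma form2_ext (s t : form2) : (forall h g, s h g = t h g) -> s = t.
Proof.
case: s t => [s sP] [t tP] /= st.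
have E : s = t by apply: funext => h; apply: funext => g.
by rewrite E in sP *; rewrite (Prop_irrelevance sP tP).
Qed.

Lemma form3_ext (p q : form3) : (forall h g l, p h g l = q h g l) -> p = q.
Proof.
case: p q => [p pP] [q qP] /= pq.
have E : p = q by do 3![apply: funext => ?].
by rewrite E in pP *; rewrite (Prop_irrelevance pP qP).
Qed.

(** Convolution: forms are themselves multilinear maps on the regular comodule,
    and the product is their action on one another. *)
Definition mul2 (s t : form2) := Form2 (act2_bilinear (form2P s) (form2P t)).
Definition mul3 (p q : form3) := Form3 (act3_trilinear (form3P p) (form3P q)).

Lemma counit_linear : linear (counit : H -> k^o).
Proof. exact: linearP. Qed.

Lemma mulr_bilinear : bilinear_map (fun x y : k^o => x * y : k^o).
Proof.
by split=> [y c u v|x c u v] /=; rewrite ?mulrDl ?mulrDr -?scalerAl -?scalerAr.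
Qed.

Lemma counit_mul_bilinear :
  bilinear_map (fun (h : H) (x : k^o) => counit h * x : k^o).
Proof. exact: (scale_bilinear counit_linear (F := fun x : k^o => x : k^o)). Qed.

Lemma mul_counit_bilinear :
  bilinear_map (fun (x : k^o) (h : H) => x * counit h : k^o).
Proof.
split=> [h|x]; first exact: mulr_bilinear.1.
exact: linear_comp counit_linear (mulr_bilinear.2 x).
Qed.

Definition one2 : form2 := Form2 (scale_bilinear counit_linear counit_linear).

Definition one3 : form3 :=
  Form3 (trilinear_nestr (form2P one2) counit_mul_bilinear).

Definition flip2 (s : form2) : form2 := Form2 (bilinear_flip (form2P s)).
Definition swap12 (p : form3) : form3 := Form3 (trilinear_swap12 (form3P p)).
Definition swap23 (p : form3) : form3 := Form3 (trilinear_swap23 (form3P p)).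

(** The pullbacks of a form s along coalgebra maps from H (x) H (x) H to
    H (x) H: the subscript lists which arguments are multiplied together, and an
    argument that is absent from it is sent through the counit. Since they come
    from coalgebra maps they respect convolution, and a coalgebra map such as
    the multiplication does so by [act2_nestl] applied to [mul_bimap]. *)
Definition form12 (s : form2) : form3 :=
  Form3 (trilinear_nestl (form2P s) mul_counit_bilinear).
Definition form23 (s : form2) : form3 :=
  Form3 (trilinear_nestr (form2P s) counit_mul_bilinear).
Definition form12_3 (s : form2) : form3 :=
  Form3 (trilinear_nestl (mul_bimap H).1 (form2P s)).
Definition form1_23 (s : form2) : form3 :=
  Form3 (trilinear_nestr (mul_bimap H).1 (form2P s)).
Definition form13 (s : form2) : form3 := swap23 (form12 s).

Implicit Types (s t : form2) (p q r : form3).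

Lemma mul2A s t u : mul2 s (mul2 t u) = mul2 (mul2 s t) u.
Proof. by apply: form2_ext => h g; apply: act2_act2; exact: form2P. Qed.

Lemma mul2_1l s : mul2 one2 s = s.
Proof. by apply: form2_ext => h g; apply: act2_counit; exact: form2P. Qed.

Lemma mul3A p q r : mul3 p (mul3 q r) = mul3 (mul3 p q) r.
Proof. by apply: form3_ext => h g l; apply: act3_act3; exact: form3P. Qed.

Lemma mul3_1l p : mul3 one3 p = p.
Proof. by apply: form3_ext => h g l; apply: act3_counit; exact: form3P. Qed.

Lemma flip2M s t : flip2 (mul2 s t) = mul2 (flip2 s) (flip2 t).
Proof. by apply: form2_ext => h g; rewrite /= -act2_flip. Qed.

Lemma swap12M p q : swap12 (mul3 p q) = mul3 (swap12 p) (swap12 q).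
Proof. by apply: form3_ext => h g l; rewrite /= -act3_swap12. Qed.

Lemma swap23M p q : swap23 (mul3 p q) = mul3 (swap23 p) (swap23 q).
Proof. by apply: form3_ext => h g l; rewrite /= -act3_swap23. Qed.

Lemma form12M s t : form12 (mul2 s t) = mul3 (form12 s) (form12 t).
Proof.
apply: form3_ext => h g l /=.
rewrite act3_counit3; last exact: form3P (form12 t).
exact: (linear_act2 s t h g (mul_counit_bilinear.1 l)).
Qed.

Lemma form23M s t : form23 (mul2 s t) = mul3 (form23 s) (form23 t).
Proof.
apply: form3_ext => h g l /=.
rewrite act3_counit1; last exact: form3P (form23 t).
exact: (linear_act2 s t g l (counit_mul_bilinear.2 h)).
Qed.

Lemma form12_3M s t : form12_3 (mul2 s t) = mul3 (form12_3 s) (form12_3 t).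
Proof.
apply: form3_ext => h g l.
exact: act2_nestl (form2P s) (mul_bimap H) (form2P t).
Qed.

Lemma form1_23M s t : form1_23 (mul2 s t) = mul3 (form1_23 s) (form1_23 t).
Proof.
apply: form3_ext => h g l.
exact: act2_nestr (form2P s) (mul_bimap H) (form2P t).
Qed.

Lemma form12_1 : form12 one2 = one3.
Proof. by apply: form3_ext => h g l; exact/esym/mulrA. Qed.

Lemma form23_1 : form23 one2 = one3.
Proof. by apply: form3_ext. Qed.

Lemma form1_23_1 : form1_23 one2 = one3.
Proof. by apply: form3_ext => h g l /=; rewrite counitM. Qed.

Lemma swap12K : involutive swap12. Proof. by move=> p; apply: form3_ext. Qed.
Lemma swap23K : involutive swap23. Proof. by move=> p; apply: form3_ext. Qed.

Lemma swap12_form12 s : swap12 (form12 s) = form12 (flip2 s).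
Proof. exact: form3_ext. Qed.

Lemma swap23_form23 s : swap23 (form23 s) = form23 (flip2 s).
Proof. exact: form3_ext. Qed.

Lemma swap12_form13 s : swap12 (form13 s) = form23 s.
Proof. by apply: form3_ext => h g l; exact: mulrC. Qed.

Lemma swap12_form23 s : swap12 (form23 s) = form13 s.
Proof. by rewrite -swap12_form13 swap12K. Qed.

Lemma swap23_form13 s : swap23 (form13 s) = form12 s.
Proof. exact: swap23K. Qed.

Lemma rot_form12_3 s : swap12 (swap23 (form12_3 s)) = form1_23 (flip2 s).
Proof. exact: form3_ext. Qed.

Lemma rot_form1_23 s : swap23 (swap12 (form1_23 s)) = form12_3 (flip2 s).
Proof. exact: form3_ext. Qed.

Section CommutativeProduct.
Hypothesis mulC : forall h g : H, h * g = g * h.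

Lemma swap12_form12_3 s : swap12 (form12_3 s) = form12_3 s.
Proof. by apply: form3_ext => h g l; rewrite /= mulC. Qed.

Lemma swap23_form1_23 s : swap23 (form1_23 s) = form1_23 s.
Proof. by apply: form3_ext => h g l; rewrite /= mulC. Qed.

End CommutativeProduct.

Section Cocommutative.
Hypothesis cc : cocommutative H.

Lemma mul2C s t : mul2 s t = mul2 t s.
Proof. by apply: form2_ext => h g; apply: act2C => //; exact: form2P. Qed.

Lemma mul3C p q : mul3 p q = mul3 q p.
Proof. by apply: form3_ext => h g l; apply: act3C => //; exact: form3P. Qed.

Lemma mul3CA p q r : mul3 p (mul3 q r) = mul3 q (mul3 p r).
Proof. by rewrite mul3A (mul3C p) -mul3A. Qed.

End Cocommutative.

End Forms.

(** * Twisting by a cocycle *)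

Section Twist.
Variables (k : fieldType) (H : hopfAlgType k).
Hypothesis mulC : forall h g : H, h * g = g * h.
Hypothesis cc : cocommutative H.
Implicit Types (U V W Z : comodType H) (X : lmodType k).

(** The form s and the coaction of f(u, v) each consume one leg of u and of v;
    cocommutativity lets them exchange these legs. *)
Lemma twist_bimap U V W (s : form2 H) (f : U -> V -> W) :
  comodule_bimap f -> comodule_bimap (twist s f).
Proof.
move=> fP; split; first exact: (act2_bilinear (form2P s) fP.1).
move=> u v; rewrite (linear_act2 _ _ _ _ (linearP coact)).
pose T (h h' : H) u (g g' : H) v : tensor H W :=
  (s h g : k) *: ((h' * g') ⊗ f u v).
transitivity (\sum_(x <- rho u) \sum_(x' <- rho x.2) \sum_(y <- rho v)
    \sum_(y' <- rho y.2) T x.1 x'.1 x'.2 y.1 y'.1 y'.2).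
  apply: eq_bigr => x _; rewrite exchange_big; apply: eq_bigr => y _.
  rewrite fP.2 scaler_sumr; apply: eq_bigr => x' _.
  by rewrite scaler_sumr.
transitivity (\sum_(x <- rho u) \sum_(x' <- rho x.2) \sum_(y <- rho v)
    \sum_(y' <- rho y.2) T x'.1 x.1 x'.2 y'.1 y.1 y'.2); last first.
  apply: eq_bigr => x _; rewrite exchange_big; apply: eq_bigr => y _.
  rewrite (linear_act2 _ _ _ _ ((pure_bilinear _ _).2 (x.1 * y.1))).
  by [].
have TP h h' u' : trilinear_map (T h h' u').
  split=> [g v'|g]; first by apply: linear_scalel; exact: (form2P s).2.
  split=> [v'|g']; apply: linear_scaler.
    by apply: linear_comp ((pure_bilinear _ _).1 _); exact: (mul_bimap H).1.2.
  by apply: linear_comp ((pure_bilinear _ _).2 _); exact: fP.1.2.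
transitivity (\sum_(x <- rho u) \sum_(x' <- rho x.2) \sum_(y <- rho v)
    \sum_(y' <- rho y.2) T x.1 x'.1 x'.2 y'.1 y.1 y'.2).
  by do 2![apply: eq_bigr => ? _]; exact: rho_swap.
apply: (rho_swap (T := fun h h' u => \sum_(y <- rho v)
  \sum_(y' <- rho y.2) T h h' u y'.1 y.1 y'.2)) => //.
split=> [h' u'|h]; last split=> [u'|h']; do 2!apply: sum_linear => ?.
- by apply: linear_scalel; exact: (form2P s).1.
- apply: linear_scaler; apply: linear_comp ((pure_bilinear _ _).1 _).
  exact: (mul_bimap H).1.1.
- apply: linear_scaler; apply: linear_comp ((pure_bilinear _ _).2 _).
  exact: fP.1.1.
Qed.

Lemma flip_bimap U V W (f : U -> V -> W) :
  comodule_bimap f -> comodule_bimap (fun v u => f u v).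
Proof.
move=> fP; split=> [|v u]; first exact: bilinear_flip fP.1.
rewrite fP.2 exchange_big; apply: eq_bigr => y _; apply: eq_bigr => x _.
by rewrite mulC.
Qed.

Variables beta sigma sigma' : form2 H.
Hypothesis sigmaV : mul2 sigma sigma' = one2 H.
Hypothesis cocycle :
  mul3 (form12 sigma) (form12_3 sigma) = mul3 (form23 sigma) (form1_23 sigma).

(** The convolution formula for beta_sigma, with sigma' the inverse of sigma. *)
Definition twisted_form : form2 H := mul2 (flip2 sigma') (mul2 beta sigma).

Definition cocycle3 : form3 H := mul3 (form12 sigma) (form12_3 sigma).

Local Notation beta_s := twisted_form.
Local Notation sigma3 := cocycle3.

(** Convolution with beta_sigma replaces the opposite cocycle by the cocycle,
    at the price of a factor beta; this is how the twisted braiding repairs a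
    permutation of the arguments of sigma. *)
Lemma twisted_formM : mul2 beta_s (flip2 sigma) = mul2 sigma beta.
Proof.
rewrite /beta_s (mul2C cc _ (flip2 sigma)) mul2A -flip2M sigmaV.
have -> : flip2 (one2 H) = one2 H by apply: form2_ext => h g; exact: mulrC.
by rewrite mul2_1l mul2C.
Qed.

(** The next four lemmas say that sigma3 intertwines the braidings for beta and
    for beta_sigma, one for each permutation of the arguments that occurs in the
    axioms. Each time one of the two factorisations of sigma3 has a factor that
    the permutation fixes or merely shifts, and another that it turns into its
    opposite; [twisted_formM] absorbs the latter. *)
Lemma braid12_sigma3 :
  mul3 (form12 beta_s) (swap12 sigma3) = mul3 sigma3 (form12 beta).
Proof.
rewrite swap12M swap12_form12 swap12_form12_3 // mul3A -form12M twisted_formM.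
by rewrite form12M -mul3A (mul3C cc (form12 beta)) mul3A.
Qed.

Lemma braid23_sigma3 :
  mul3 (form23 beta_s) (swap23 sigma3) = mul3 sigma3 (form23 beta).
Proof.
rewrite /sigma3 cocycle swap23M swap23_form23 swap23_form1_23 // mul3A -form23M.
by rewrite twisted_formM form23M -mul3A (mul3C cc (form23 beta)) mul3A.
Qed.

Lemma braid1_23_sigma3 :
  mul3 (form1_23 beta_s) (swap12 (swap23 sigma3)) = mul3 sigma3 (form1_23 beta).
Proof.
rewrite {1}/sigma3 swap23M swap12M rot_form12_3 (mul3CA cc) -form1_23M.
rewrite twisted_formM form1_23M mul3A; congr mul3.
by rewrite /sigma3 cocycle -[swap23 (form12 _)]/(form13 _) swap12_form13.
Qed.

Lemma braid12_3_sigma3 :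
  mul3 (form12_3 beta_s) (swap23 (swap12 sigma3)) = mul3 sigma3 (form12_3 beta).
Proof.
rewrite {1}/sigma3 cocycle swap12M swap23M rot_form1_23 (mul3CA cc) -form12_3M.
by rewrite twisted_formM form12_3M mul3A swap12_form23 swap23_form13.
Qed.

(** Bilinearity moves the inner cocycle to the outside, and [act2_nestl] turns
    the outer one into a form on three arguments; their convolution product is
    sigma3. *)
Lemma twist_nestl U V W Z X (f : U -> V -> Z) (F : Z -> W -> X) u v w :
  comodule_bimap f -> bilinear_map F ->
  act2 sigma F (act2 sigma f u v) w =
  act3 sigma3 (fun u v w => F (f u v) w) u v w.
Proof.
move=> fP FP; have sFP := act2_bilinear (form2P sigma) FP.
have NP := trilinear_nestl fP.1 FP.
rewrite (linear_act2 _ _ _ _ (sFP.1 w)).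
rewrite -(act3_act3 _ _ _ (form3P (form12 sigma)) (form3P (form12_3 sigma)) NP).
rewrite act3_counit3; last exact: act3_trilinear (form3P _) NP.
by apply: eq_act2 => u' v'; apply: act2_nestl fP FP; exact: form2P.
Qed.

Lemma twist_nestr U V W Z X (f : V -> W -> Z) (F : U -> Z -> X) u v w :
  comodule_bimap f -> bilinear_map F ->
  act2 sigma F u (act2 sigma f v w) =
  act3 sigma3 (fun u v w => F u (f v w)) u v w.
Proof.
move=> fP FP; have sFP := act2_bilinear (form2P sigma) FP.
have NP := trilinear_nestr fP.1 FP.
rewrite (linear_act2 _ _ _ _ (sFP.2 u)) /sigma3 cocycle.
rewrite -(act3_act3 _ _ _ (form3P (form23 sigma)) (form3P (form1_23 sigma)) NP).
rewrite act3_counit1; last exact: act3_trilinear (form3P _) NP.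
by apply: eq_act2 => v' w'; apply: act2_nestr fP FP; exact: form2P.
Qed.

Lemma twist_braid U V X (F : V -> U -> X) u v :
  bilinear_map F ->
  act2 beta_s (fun u v => act2 sigma F v u) u v =
  act2 sigma (fun u v => act2 beta (fun u v => F v u) u v) u v.
Proof.
move=> FP; have F'P := bilinear_flip FP.
rewrite [RHS](act2_act2 _ _ (form2P sigma) (form2P beta) F'P).
rewrite -[act2 sigma beta]/(form2_fun (mul2 sigma beta)) -twisted_formM.
rewrite -[RHS](act2_act2 _ _ (form2P beta_s) (form2P (flip2 sigma)) F'P).
by apply: eq_act2 => u' v'; exact/esym/act2_flip.
Qed.

Section Braid.
Variables (U V W : comodType H) (X : lmodType k).
Implicit Types (u : U) (v : V) (w : W).

Lemma twist_braid12 (F : V -> U -> W -> X) u v w :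
  trilinear_map F ->
  act2 beta_s (fun u v => act3 sigma3 F v u w) u v =
  act3 sigma3 (fun u v w => act2 beta (fun u v => F v u w) u v) u v w.
Proof.
move=> FP; have F'P := trilinear_swap12 FP.
transitivity (act3 (mul3 (form12 beta_s) (swap12 sigma3))
    (fun u v w => F v u w) u v w).
  rewrite -(act3_act3 _ _ _ (form3P _) (form3P (swap12 _)) F'P).
  rewrite act3_counit3; last exact: act3_trilinear (form3P _) F'P.
  by apply: eq_act2 => u' v'; rewrite -act3_swap12.
rewrite braid12_sigma3 -(act3_act3 _ _ _ (form3P _) (form3P (form12 _)) F'P).
by apply: eq_act3 => u' v' w'; exact: act3_counit3.
Qed.

Lemma twist_braid23 (F : U -> W -> V -> X) u v w :
  trilinear_map F ->
  act2 beta_s (fun v w => act3 sigma3 F u w v) v w =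
  act3 sigma3 (fun u v w => act2 beta (fun v w => F u w v) v w) u v w.
Proof.
move=> FP; have F'P := trilinear_swap23 FP.
transitivity (act3 (mul3 (form23 beta_s) (swap23 sigma3))
    (fun u v w => F u w v) u v w).
  rewrite -(act3_act3 _ _ _ (form3P _) (form3P (swap23 _)) F'P).
  rewrite act3_counit1; last exact: act3_trilinear (form3P _) F'P.
  by apply: eq_act2 => v' w'; rewrite -act3_swap23.
rewrite braid23_sigma3 -(act3_act3 _ _ _ (form3P _) (form3P (form23 _)) F'P).
by apply: eq_act3 => u' v' w'; exact: act3_counit1.
Qed.

Lemma twist_braid1_23 (F : V -> W -> U -> X) u v w :
  trilinear_map F ->
  act3 (form1_23 beta_s) (fun u v w => act3 sigma3 F v w u) u v w =
  act3 sigma3 (act3 (form1_23 beta) (fun u v w => F v w u)) u v w.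
Proof.
move=> FP; have F'P := trilinear_rotl FP.
rewrite [RHS](act3_act3 _ _ _ (form3P _) (form3P _) F'P).
rewrite -[act3 sigma3 (form1_23 _)]/(form3_fun (mul3 sigma3 (form1_23 beta))).
rewrite -braid1_23_sigma3.
rewrite -[RHS](act3_act3 _ _ _ (form3P _) (form3P (swap12 _)) F'P).
by apply: eq_act3 => u' v' w'; rewrite -act3_swap23 -act3_swap12.
Qed.

Lemma twist_braid12_3 (F : W -> U -> V -> X) u v w :
  trilinear_map F ->
  act3 (form12_3 beta_s) (fun u v w => act3 sigma3 F w u v) u v w =
  act3 sigma3 (act3 (form12_3 beta) (fun u v w => F w u v)) u v w.
Proof.
move=> FP; have F'P := trilinear_rotr FP.
rewrite [RHS](act3_act3 _ _ _ (form3P _) (form3P _) F'P).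
rewrite -[act3 sigma3 (form12_3 _)]/(form3_fun (mul3 sigma3 (form12_3 beta))).
rewrite -braid12_3_sigma3.
rewrite -[RHS](act3_act3 _ _ _ (form3P _) (form3P (swap23 _)) F'P).
by apply: eq_act3 => u' v' w'; rewrite -act3_swap12 -act3_swap23.
Qed.

End Braid.

(** The twisted Jacobi sum is sigma3 acting on the original Jacobi sum. *)
Lemma twist_lie (L : comodType H) (br : L -> L -> L) :
  lie_algebra beta br -> lie_algebra beta_s (twist sigma br).
Proof.
case=> brP antisym jacobi; split; first exact: twist_bimap.
  move=> a b; rewrite -[RHS]/(- act2 beta_s (fun a b => act2 sigma br b a) a b).
  rewrite (twist_braid _ _ brP.1) -act2N.
  by apply: eq_act2 => a' b'; exact: antisym.
move=> a b c; have NP := trilinear_nestl brP.1 brP.1.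
pose N := fun a b c => br (br a b) c.
pose N' := fun a b c => twist sigma br (twist sigma br a b) c.
have N'E a' b' c' : N' a' b' c' = act3 sigma3 N a' b' c'.
  by apply: twist_nestl; [exact: brP|exact: brP.1].
transitivity (N' a b c +
    act3 (form1_23 beta_s) (fun a b c => N' b c a) a b c +
    act3 (form12_3 beta_s) (fun a b c => N' c a b) a b c); first by [].
have -> : act3 (form1_23 beta_s) (fun a b c => N' b c a) a b c =
    act3 sigma3 (act3 (form1_23 beta) (fun a b c => N b c a)) a b c.
  by rewrite -twist_braid1_23 //; apply: eq_act3.
have -> : act3 (form12_3 beta_s) (fun a b c => N' c a b) a b c =
    act3 sigma3 (act3 (form12_3 beta) (fun a b c => N c a b)) a b c.
  by rewrite -twist_braid12_3 //; apply: eq_act3.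
rewrite N'E -!act3D -[RHS](act3_0 L sigma3 a b c).
by apply: eq_act3 => a' b' c'; exact: jacobi.
Qed.

Section Matched.
Variables (A L : comodType H) (brA : A -> A -> A) (brL : L -> L -> L).
Variables (lact : L -> A -> A) (ract : L -> A -> L).

Lemma twist_left_module :
  comodule_bimap brL -> left_lie_module beta brL lact ->
  left_lie_module beta_s (twist sigma brL) (twist sigma lact).
Proof.
move=> brP [actP mod]; split=> [|h g a]; first exact: twist_bimap.
pose N h g a := lact h (lact g a).
pose N' h g a := twist sigma lact h (twist sigma lact g a).
have NP : trilinear_map N := trilinear_nestr actP.1 actP.1.
have N'E h' g' a' : N' h' g' a' = act3 sigma3 N h' g' a'.
  by apply: twist_nestr; [exact: actP|exact: actP.1].
transitivity (N' h g a - act2 beta_s (fun h g => N' g h a) h g); last by [].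
rewrite N'E (eq_act2 _ _ _ (fun h' g' => N'E g' h' a)).
rewrite twist_braid12 // -act3N -act3D.
rewrite [LHS]twist_nestl //; last exact: actP.1.
by apply: eq_act3 => h' g' a'; exact: mod.
Qed.

Lemma twist_right_module :
  comodule_bimap brA -> right_lie_module beta brA ract ->
  right_lie_module beta_s (twist sigma brA) (twist sigma ract).
Proof.
move=> brP [actP mod]; split=> [|h a b]; first exact: twist_bimap.
pose N h a b := ract (ract h a) b.
pose N' h a b := twist sigma ract (twist sigma ract h a) b.
have NP : trilinear_map N := trilinear_nestl actP.1 actP.1.
have N'E h' a' b' : N' h' a' b' = act3 sigma3 N h' a' b'.
  by apply: twist_nestl; [exact: actP|exact: actP.1].
transitivity (N' h a b - act2 beta_s (fun a b => N' h b a) a b); last by [].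
rewrite N'E (eq_act2 _ _ _ (fun a' b' => N'E h b' a')).
rewrite twist_braid23 // -act3N -act3D.
rewrite [LHS]twist_nestr //; last exact: actP.1.
by apply: eq_act3 => h' a' b'; exact: mod.
Qed.

Lemma twist_matched_pair :
  matched_pair beta brA brL lact ract ->
  matched_pair beta_s (twist sigma brA) (twist sigma brL)
    (twist sigma lact) (twist sigma ract).
Proof.
case=> lieA lieL lmod rmod BB1 BB2.
have brAP := lie_comodule_bimap lieA; have brLP := lie_comodule_bimap lieL.
have [lP _] := lmod; have [rP _] := rmod.
split; [exact: twist_lie|exact: twist_lie|exact: twist_left_module|
  exact: twist_right_module| |].
- move=> h a b.
  pose N1 a h b := brA a (lact h b); pose N2 h a b := lact (ract h a) b.
  pose N1' a h b := twist sigma brA a (twist sigma lact h b).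
  pose N2' h a b := twist sigma lact (twist sigma ract h a) b.
  have N1P : trilinear_map N1 := trilinear_nestr lP.1 brAP.1.
  have N2P : trilinear_map N2 := trilinear_nestl rP.1 lP.1.
  have N1E a' h' b' : N1' a' h' b' = act3 sigma3 N1 a' h' b'.
    by apply: twist_nestr => //; exact: brAP.1.
  have N2E h' a' b' : N2' h' a' b' = act3 sigma3 N2 h' a' b'.
    by apply: twist_nestl => //; exact: lP.1.
  transitivity (twist sigma brA (twist sigma lact h a) b +
      act2 beta_s (fun h a => N1' a h b) h a + N2' h a b -
      act2 beta_s (fun a b => N2' h b a) a b); last by [].
  rewrite (eq_act2 _ _ _ (fun h' a' => N1E a' h' b)) N2E.
  rewrite (eq_act2 _ _ _ (fun a' b' => N2E h b' a')).
  rewrite twist_braid12 // twist_braid23 //.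
  rewrite [twist _ brA (twist _ _ _ _) _]twist_nestl //; last exact: brAP.1.
  rewrite -act3N -!act3D [LHS]twist_nestr //; last exact: lP.1.
  by apply: eq_act3 => h' a' b'; exact: BB1.
- move=> h g a.
  pose N1 h a g := brL (ract h a) g; pose N2 h g a := ract h (lact g a).
  pose N1' h a g := twist sigma brL (twist sigma ract h a) g.
  pose N2' h g a := twist sigma ract h (twist sigma lact g a).
  have N1P : trilinear_map N1 := trilinear_nestl rP.1 brLP.1.
  have N2P : trilinear_map N2 := trilinear_nestr lP.1 rP.1.
  have N1E h' a' g' : N1' h' a' g' = act3 sigma3 N1 h' a' g'.
    by apply: twist_nestl => //; exact: brLP.1.
  have N2E h' g' a' : N2' h' g' a' = act3 sigma3 N2 h' g' a'.
    by apply: twist_nestr => //; exact: rP.1.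
  transitivity (twist sigma brL h (twist sigma ract g a) +
      act2 beta_s (fun g a => N1' h a g) g a + N2' h g a -
      act2 beta_s (fun h g => N2' g h a) h g); last by [].
  rewrite (eq_act2 _ _ _ (fun g' a' => N1E h a' g')) N2E.
  rewrite (eq_act2 _ _ _ (fun h' g' => N2E g' h' a)).
  rewrite twist_braid12 // twist_braid23 //.
  rewrite [twist _ brL _ (twist _ _ _ _)]twist_nestr //; last exact: brLP.1.
  rewrite -act3N -!act3D [LHS]twist_nestl //; last exact: rP.1.
  by apply: eq_act3 => h' g' a'; exact: BB2.
Qed.

End Matched.

End Twist.

(** * Comodule maps *)

Section ComoduleMaps.
Variables (k : fieldType) (H : hopfAlgType k).
Implicit Types (U V W Z : comodType H) (X : lmodType k).

Definition comodule_map V W (f : V -> W) : Prop :=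
  linear f /\ forall v, coact (f v) = pushr f (coact v).

Lemma rho_map V W X (f : V -> W) (g : H -> W -> X) v :
  comodule_map f -> bilinear_map g ->
  \sum_(z <- rho (f v)) g z.1 z.2 = \sum_(x <- rho v) g x.1 (f x.2).
Proof.
move=> [_ fc] gP; rewrite -[LHS]/(tlift g (coact (f v))) fc pushrE tlift_sum //.
by apply: eq_bigr => x _; rewrite tlift_pure.
Qed.

Lemma act1_map V W X (s : H -> k^o) (F : W -> X) (f : V -> W) v :
  linear s -> linear F -> comodule_map f ->
  act1 s F (f v) = act1 s (fun v => F (f v)) v.
Proof.
move=> sP FP fP; apply: (rho_map (g := fun h w => s h *: F w)) => //.
exact: scale_bilinear.
Qed.

Lemma act2_map U U' V V' X (s : form2 H) (F : U' -> V' -> X) (f : U -> U')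
    (g : V -> V') u v :
  bilinear_map F -> comodule_map f -> comodule_map g ->
  act2 s F (f u) (g v) = act2 s (fun u v => F (f u) (g v)) u v.
Proof.
move=> FP fP gP; have sP := form2P s.
rewrite /act2 (rho_map (g := fun h z => act1 (s h) (F z) (g v))) //.
  by apply: eq_bigr => x _; apply: act1_map => //; [exact: sP.2|exact: FP.2].
by split=> [z|h]; [apply: act1_linl; exact: sP.1|apply: act1_linr; exact: FP.1].
Qed.

Lemma act3_map U U' V V' W W' X (p : form3 H) (F : U' -> V' -> W' -> X)
    (e : U -> U') (f : V -> V') (g : W -> W') u v w :
  trilinear_map F -> comodule_map e -> comodule_map f -> comodule_map g ->
  act3 p F (e u) (f v) (g w) = act3 p (fun u v w => F (e u) (f v) (g w)) u v w.
Proof.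
move=> FP eP fP gP; have pP := form3P p.
rewrite /act3 (rho_map (g := fun h z => act2 (p h) (F z) (f v) (g w))) //.
  apply: eq_bigr => x _.
  by rewrite (act2_map (Form2 (pP.2 x.1)) _ _ (FP.2 _) fP gP).
by split=> [z|h]; [apply: act2_linl; exact: pP.1|apply: act2_linr; exact: FP.1].
Qed.

Lemma bimap_add U V W (f g : U -> V -> W) :
  comodule_bimap f -> comodule_bimap g ->
  comodule_bimap (fun u v => f u v + g u v).
Proof.
move=> [fP fc] [gP gc]; split=> [|u v].
  split=> [v c x y|u c x y] /=; first by rewrite fP.1 gP.1 scalerDr addrACA.
  by rewrite fP.2 gP.2 scalerDr addrACA.
rewrite linearD fc gc -big_split; apply: eq_bigr => x _ /=.
rewrite -big_split; apply: eq_bigr => y _ /=.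
by rewrite -[f x.2 y.2]scale1r (pure_bilinear _ _).2 !scale1r.
Qed.

Lemma bimap_opp U V W (f : U -> V -> W) :
  comodule_bimap f -> comodule_bimap (fun u v => - f u v).
Proof.
move=> [fP fc]; split=> [|u v].
  split=> [v c x y|u c x y] /=; first by rewrite fP.1 opprD scalerN.
  by rewrite fP.2 opprD scalerN.
rewrite linearN fc -sumrN; apply: eq_bigr => x _ /=.
rewrite -sumrN; apply: eq_bigr => y _ /=.
rewrite -[in RHS]scaleN1r (linear_mapZ _ _ ((pure_bilinear _ _).2 _)).
by rewrite scaleN1r.
Qed.

Lemma bimap_comp U U' V V' W (F : U' -> V' -> W) (f : U -> U') (g : V -> V') :
  comodule_bimap F -> comodule_map f -> comodule_map g ->
  comodule_bimap (fun u v => F (f u) (g v)).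
Proof.
move=> [FP Fc] fP gP; split=> [|u v].
  split=> [v|u]; first exact: linear_comp fP.1 (FP.1 _).
  exact: linear_comp gP.1 (FP.2 _).
rewrite Fc.
rewrite (rho_map (g := fun h z => \sum_(y <- rho (g v)) (h * y.1) ⊗ F z y.2)) //.
  apply: eq_bigr => x _.
  rewrite (rho_map (g := fun h z => (x.1 * h) ⊗ F (f x.2) z)) //.
  split=> [z|h]; last exact: linear_comp (FP.2 _) ((pure_bilinear _ _).2 _).
  by apply: linear_comp ((pure_bilinear _ _).1 _); exact: (mul_bimap H).1.2.
split=> [z|h]; apply: sum_linear => y.
  by apply: linear_comp ((pure_bilinear _ _).1 _); exact: (mul_bimap H).1.1.
exact: linear_comp (FP.1 _) ((pure_bilinear _ _).2 _).
Qed.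

Lemma bimap_pair U V W Z (f : U -> V -> W) (g : U -> V -> Z) :
  comodule_bimap f -> comodule_bimap g ->
  comodule_bimap (fun u v => (f u v, g u v) : (W * Z)%type).
Proof.
move=> [fP fc] [gP gc]; split=> [|u v].
  split=> [v c x y|u c x y] /=; first by rewrite fP.1 gP.1.
  by rewrite fP.2 gP.2.
rewrite [LHS]coact_prodE /= fc gc.
have pushS (Y : comodType H) (i : Y -> (W * Z)%type) (q : U -> V -> Y) :
    linear i ->
    pushr i (\sum_(x <- rho u) \sum_(y <- rho v) (x.1 * y.1) ⊗ q x.2 y.2) =
    \sum_(x <- rho u) \sum_(y <- rho v) (x.1 * y.1) ⊗ i (q x.2 y.2).
  move=> iP; have jP := @pureDr_bilinear k H _ _ _ iP.
  rewrite [LHS]tlift_sum //; apply: eq_bigr => x _; rewrite tlift_sum //.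
  by apply: eq_bigr => y _; rewrite tlift_pure.
rewrite !pushS; [|exact: dsum_inr_linear|exact: dsum_inl_linear].
rewrite -big_split; apply: eq_bigr => x _ /=.
rewrite -big_split; apply: eq_bigr => y _ /=.
rewrite -[x.1 * y.1 ⊗ dsum_inl _ _]scale1r -(pure_bilinear _ _).2 scale1r.
by congr (_ ⊗ (_, _)); rewrite /= ?addr0 ?add0r.
Qed.

Lemma pushr_pushr (V W Z : lmodType k) (f : V -> W) (g : W -> Z)
    (t : tensor H V) :
  linear g -> pushr g (pushr f t) = pushr (fun v => g (f v)) t.
Proof.
move=> gP; have gB := @pureDr_bilinear k H _ _ _ gP.
rewrite (pushrE f) [LHS]tlift_sum //.
by apply: eq_bigr => p _; rewrite tlift_pure.
Qed.

Lemma pushr_id (V : lmodType k) (t : tensor H V) : pushr id t = t.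
Proof. exact: sum_sweedler. Qed.

Lemma pushr_0 (V W : lmodType k) (t : tensor H V) :
  pushr (fun _ => 0 : W) t = 0.
Proof.
rewrite pushrE big1 // => p _.
rewrite -(scale0r (0 : W)) (linear_mapZ _ _ ((pure_bilinear _ _).2 _)).
by rewrite scale0r.
Qed.

Variables A L : comodType H.

Lemma fst_linear : linear (fst : (A * L)%type -> A). Proof. by []. Qed.
Lemma snd_linear : linear (snd : (A * L)%type -> L). Proof. by []. Qed.

Lemma fst_comodule_map : comodule_map (fst : (A * L)%type -> A).
Proof.
split=> [//|x]; rewrite [coact x]coact_prodE.
rewrite -[X in pushr _ X]scale1r scalerDr (pushr_linear fst_linear) !scale1r.
by rewrite !pushr_pushr // [X in X + _]pushr_id [X in _ + X]pushr_0 addr0.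
Qed.

Lemma snd_comodule_map : comodule_map (snd : (A * L)%type -> L).
Proof.
split=> [//|x]; rewrite [coact x]coact_prodE.
rewrite -[X in pushr _ X]scale1r scalerDr (pushr_linear snd_linear) !scale1r.
by rewrite !pushr_pushr // [X in X + _]pushr_0 [X in _ + X]pushr_id add0r.
Qed.

Lemma inl_comodule_map : comodule_map (@dsum_inl k H A L).
Proof.
split=> [|a]; first exact: dsum_inl_linear.
rewrite [LHS]coact_prodE /= linear0 pushr0 ?addr0 //; exact: dsum_inr_linear.
Qed.

Lemma inr_comodule_map : comodule_map (@dsum_inr k H A L).
Proof.
split=> [|a]; first exact: dsum_inr_linear.
rewrite [LHS]coact_prodE /= linear0 pushr0 ?add0r //; exact: dsum_inl_linear.
Qed.

End ComoduleMaps.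

(** * The braided Jacobi identity *)

Section Braiding.
Variables (k : fieldType) (H : hopfAlgType k).
Hypothesis mulC : forall h g : H, h * g = g * h.
Hypothesis cc : cocommutative H.
Variable beta : form2 H.
Hypothesis beta1_23 : form1_23 beta = mul3 (form12 beta) (form13 beta).
Hypothesis beta12_3 : form12_3 beta = mul3 (form23 beta) (form13 beta).
Hypothesis betaV : mul2 beta (flip2 beta) = one2 H.
Implicit Types (U V W Z : comodType H) (X : lmodType k).

Lemma act3_rotl U V W X (p : form3 H) (F : V -> W -> U -> X) u v w :
  act3 p F v w u = act3 (swap12 (swap23 p)) (fun u v w => F v w u) u v w.
Proof. by rewrite -act3_swap23 -act3_swap12. Qed.

Lemma act3_rotr U V W X (p : form3 H) (F : W -> U -> V -> X) u v w :
  act3 p F w u v = act3 (swap23 (swap12 p)) (fun u v w => F w u v) u v w.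
Proof. by rewrite -act3_swap12 -act3_swap23. Qed.

Lemma act3M U V W X (p q : form3 H) (F : U -> V -> W -> X) u v w :
  trilinear_map F -> act3 p (act3 q F) u v w = act3 (mul3 p q) F u v w.
Proof. by apply: act3_act3; exact: form3P. Qed.

Lemma act3_12 U V W X (s : form2 H) (F : U -> V -> W -> X) u v w :
  trilinear_map F -> act2 s (fun u v => F u v w) u v = act3 (form12 s) F u v w.
Proof. by move=> FP; rewrite act3_counit3. Qed.

Lemma act3_23 U V W X (s : form2 H) (F : U -> V -> W -> X) u v w :
  trilinear_map F -> act2 s (fun v w => F u v w) v w = act3 (form23 s) F u v w.
Proof. by move=> FP; rewrite act3_counit1. Qed.

Lemma act3_1 U V W X (F : U -> V -> W -> X) u v w :
  trilinear_map F -> act3 (one3 H) F u v w = F u v w.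
Proof. exact: act3_counit. Qed.

Lemma braid_invol U V X (F : U -> V -> X) u v :
  bilinear_map F ->
  act2 beta (fun u v => act2 beta (fun v u => F u v) v u) u v = F u v.
Proof.
move=> FP; transitivity (act2 beta (act2 (flip2 beta) F) u v).
  by apply: eq_act2 => u' v'; rewrite -act2_flip.
rewrite (act2_act2 _ _ (form2P beta) (form2P (flip2 beta)) FP).
rewrite -[act2 beta _]/(form2_fun (mul2 beta (flip2 beta))) betaV.
exact: act2_counit.
Qed.

(** Braiding v past f(u, w) braids it past u and past w, and the second braiding
    is cancelled by the one already applied to v and w. *)
Lemma braid_absorb U V W Z X (f : U -> W -> Z) (F : V -> Z -> X) u v w :
  comodule_bimap f -> bilinear_map F ->
  act2 beta (fun v w => act2 beta (fun z v => F v z) (f u w) v) v w =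
  act2 beta (fun u v => F v (f u w)) u v.
Proof.
move=> fP FP; pose N u v w := F v (f u w).
have NP : trilinear_map N := trilinear_swap12 (trilinear_nestr fP.1 FP).
have beta13_2 :
    swap23 (form12_3 beta) = mul3 (form23 (flip2 beta)) (form12 beta).
  by rewrite beta12_3 swap23M swap23_form23 swap23_form13.
transitivity (act3 (form23 beta) (act3 (swap23 (form12_3 beta)) N) u v w).
  rewrite -act3_23; last exact: act3_trilinear (form3P (swap23 _)) NP.
  apply: eq_act2 => v' w'.
  rewrite (act2_nestl _ _ _ (form2P beta) fP (bilinear_flip FP)).
  by rewrite -act3_swap23.
rewrite act3M // beta13_2 mul3A -form23M betaV form23_1 mul3_1l.
by rewrite -(act3_12 _ _ _ _ NP).
Qed.

Section Jacobi.
Variables (M : comodType H) (br : M -> M -> M).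
Hypothesis brP : comodule_bimap br.

(** The left-hand side of the braided Jacobi identity. *)
Definition jacobiator : M -> M -> M -> M := fun a b c =>
  br (br a b) c + act3 (form1_23 beta) (fun a b c => br (br b c) a) a b c +
  act3 (form12_3 beta) (fun a b c => br (br c a) b) a b c.

Lemma jacobiator_trilinear : trilinear_map jacobiator.
Proof.
have NP := trilinear_nestl brP.1 brP.1.
have addP (F G : M -> M -> M -> M) : trilinear_map F -> trilinear_map G ->
    trilinear_map (fun a b c => F a b c + G a b c).
  move=> FP GP; split=> [v w c x y|u].
    by rewrite FP.1 GP.1 scalerDr addrACA.
  split=> [v c x y|w c x y].
    by rewrite (FP.2 u).1 (GP.2 u).1 scalerDr addrACA.
  by rewrite (FP.2 u).2 (GP.2 u).2 scalerDr addrACA.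
have lP := act3_trilinear (form3P (form1_23 beta)) (trilinear_rotl NP).
have rP := act3_trilinear (form3P (form12_3 beta)) (trilinear_rotr NP).
exact: addP (addP _ _ NP lP) rP.
Qed.

(** Braided rotation of three arguments has order three, and the Jacobi sum is
    the sum over one orbit. *)
Lemma jacobiator_rot a b c :
  jacobiator a b c = act3 (form1_23 beta) (fun a b c => jacobiator b c a) a b c.
Proof.
have NP := trilinear_nestl brP.1 brP.1.
pose N a b c := br (br a b) c.
have lP := trilinear_rotl NP; have rP := trilinear_rotr NP.
have rotE : mul3 (form1_23 beta) (swap12 (swap23 (form1_23 beta))) =
    form12_3 beta.
  rewrite beta1_23 swap23M swap12M swap12_form13 swap23_form13 swap12_form12.
  rewrite (mul3C cc (form12 beta)) -mul3A (mul3C cc (form23 beta)).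
  rewrite (mul3A (form12 beta)) -form12M betaV form12_1 mul3_1l beta12_3.
  exact: mul3C.
rewrite /jacobiator !act3D.
have -> : act3 (form1_23 beta)
    (fun a b c => act3 (form1_23 beta) (fun a b c => N b c a) b c a) a b c =
    act3 (form12_3 beta) (fun a b c => N c a b) a b c.
  transitivity (act3 (form1_23 beta) (act3 (swap12 (swap23 (form1_23 beta)))
      (fun a b c => N c a b)) a b c).
    apply: eq_act3 => a' b' c'.
    by rewrite -(act3_rotl _ (fun a b c => N b c a)).
  by rewrite act3M // rotE.
have -> : act3 (form1_23 beta)
    (fun a b c => act3 (form12_3 beta) (fun a b c => N c a b) b c a) a b c =
    N a b c.
  transitivity
    (act3 (form1_23 beta) (act3 (swap12 (swap23 (form12_3 beta))) N) a b c).
    apply: eq_act3 => a' b' c'.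
    by rewrite -(act3_rotl _ (fun a b c => N c a b)).
  by rewrite act3M // rot_form12_3 -form1_23M betaV form1_23_1 act3_1.
by rewrite [RHS]addrC addrA.
Qed.

Hypothesis antisym :
  forall a b, br a b = - act2 beta (fun a b => br b a) a b.

(** Antisymmetry is applied to the outer bracket of the second term and to the
    inner bracket of the third. *)
Lemma jacobiator_leibniz a b c :
  jacobiator a b c =
  br (br a b) c - br a (br b c) - act2 beta (fun b c => br (br a c) b) b c.
Proof.
have LP := trilinear_nestl brP.1 brP.1; have RP := trilinear_nestr brP.1 brP.1.
rewrite /jacobiator; congr (_ + _ + _).
  transitivity (act3 (form1_23 beta) (fun a b c =>
      - act3 (form1_23 (flip2 beta)) (fun a b c => br a (br b c)) a b c) a b c).
    apply: eq_act3 => a' b' c'; rewrite antisym; congr (- _).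
    rewrite (act2_nestl _ _ _ (form2P beta) brP (bilinear_flip brP.1)).
    by rewrite (act3_rotl (form12_3 beta)).
  by rewrite act3N act3M // -form1_23M betaV form1_23_1 act3_1.
transitivity (act3 (form12_3 beta) (fun a b c =>
    - act3 (form13 (flip2 beta)) (fun a b c => br (br a c) b) a b c) a b c).
  apply: eq_act3 => a' b' c'; rewrite (antisym c' a').
  rewrite -scaleN1r (linear_mapZ _ _ (brP.1.1 b')) scaleN1r; congr (- _).
  rewrite (linear_act2 _ _ _ _ (brP.1.1 b')).
  rewrite (act3_12 _ _ _ _ (trilinear_swap12 LP)) act3_rotr.
  by rewrite swap12_form12.
rewrite act3N act3M; last exact: trilinear_swap23.
rewrite beta12_3 -mul3A -[mul3 (form13 _) _]/(mul3 (swap23 _) (swap23 _)).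
rewrite -swap23M.
rewrite -form12M betaV form12_1 (_ : swap23 (one3 H) = one3 H); last first.
  by apply: form3_ext => h g l; congr (_ * _); exact: mulrC.
rewrite mul3C // mul3_1l -act3_23 //.
exact: trilinear_swap23.
Qed.

End Jacobi.

End Braiding.

(** The additive bookkeeping that closes the two components of each of the two
    Leibniz identities for the double cross sum. *)
Section Cancellation.
Variable (V : zmodType).
Implicit Types x y s t : V.

Lemma cancel_right_module x t : x - (x - t) - t = 0.
Proof. by rewrite subKr subrr. Qed.

Lemma cancel_left_module x t : x - t - x - (- t) = 0.
Proof. by rewrite opprK addrAC subrK subrr. Qed.

Lemma cancel_left_compat x y s t : x + y - (x + s + y - t) - (- s + t) = 0.
Proof.
have -> : x + s + y - t = (x + y) + (s - t) by rewrite (addrAC x s) addrA.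
by rewrite (opprD (x + y)) addrA subrr add0r opprB (addrC (- s)) subrr.
Qed.

Lemma cancel_right_compat x y s t : x + s + y - t - (x + y) - (s - t) = 0.
Proof.
have -> : x + s + y - t = (s - t) + (x + y).
  by rewrite [RHS]addrC addrA (addrAC x s).
by rewrite addrK subrr.
Qed.

End Cancellation.

Section BilinearZero.
Variables (k : fieldType) (U V X : lmodType k) (f : U -> V -> X).
Hypothesis fP : bilinear_map f.

Lemma bilinear0l v : f 0 v = 0.
Proof. by rewrite -(scale0r (0 : U)) (linear_mapZ _ _ (fP.1 v)) scale0r. Qed.

Lemma bilinear0r u : f u 0 = 0.
Proof. by rewrite -(scale0r (0 : V)) (linear_mapZ _ _ (fP.2 u)) scale0r. Qed.

End BilinearZero.

(** * The double cross sum *)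

Section DoubleCrossSum.
Variables (k : fieldType) (H : hopfAlgType k).
Hypothesis mulC : forall h g : H, h * g = g * h.
Hypothesis cc : cocommutative H.
Variables (A L : comodType H).

Local Notation inA := (@dsum_inl k H A L).
Local Notation inL := (@dsum_inr k H A L).
Let inAP := inl_comodule_map A L.
Let inLP := inr_comodule_map A L.
Let fstP := fst_comodule_map A L.
Let sndP := snd_comodule_map A L.

Lemma trilinear_dsum_eq0 (X : lmodType k)
    (F : (A * L)%type -> (A * L)%type -> (A * L)%type -> X) :
  trilinear_map F ->
  (forall a b c, F (inA a) (inA b) (inA c) = 0) ->
  (forall a b h, F (inA a) (inA b) (inL h) = 0) ->
  (forall a h b, F (inA a) (inL h) (inA b) = 0) ->
  (forall a h g, F (inA a) (inL h) (inL g) = 0) ->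
  (forall h a b, F (inL h) (inA a) (inA b) = 0) ->
  (forall h a g, F (inL h) (inA a) (inL g) = 0) ->
  (forall h g a, F (inL h) (inL g) (inA a) = 0) ->
  (forall h g l, F (inL h) (inL g) (inL l) = 0) ->
  forall u v w, F u v w = 0.
Proof.
move=> FP F1 F2 F3 F4 F5 F6 F7 F8 u v w.
have addE (f : (A * L)%type -> X) x :
    linear f -> f x = f (inA x.1) + f (inL x.2).
  move=> fP; rewrite -[f (inA _)]scale1r -fP scale1r; congr f.
  by case: x => a h; congr (_, _); rewrite /= ?addr0 ?add0r.
have addv u' : F u' v w = F u' (inA v.1) w + F u' (inL v.2) w.
  exact: (addE (fun v => F u' v w) _ ((FP.2 u').1 w)).
have addw u' v' : F u' v' w = F u' v' (inA w.1) + F u' v' (inL w.2).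
  exact: (addE _ _ ((FP.2 u').2 v')).
rewrite (addE _ u (FP.1 v w)) (addv (inA _)) (addv (inL _)).
rewrite (addw (inA _) (inA _)) (addw (inA _) (inL _)).
rewrite (addw (inL _) (inA _)) (addw (inL _) (inL _)).
by rewrite F1 F2 F3 F4 F5 F6 F7 F8 !addr0.
Qed.

Variables (brA : A -> A -> A) (brL : L -> L -> L).
Variables (lact : L -> A -> A) (ract : L -> A -> L).
Hypothesis brAP : comodule_bimap brA.
Hypothesis brLP : comodule_bimap brL.
Hypothesis lP : comodule_bimap lact.
Hypothesis rP : comodule_bimap ract.

Lemma double_cross_sum_bimap (beta : form2 H) :
  comodule_bimap (double_cross_sum beta brA brL lact ract).
Proof.
have flP := twist_bimap cc beta (flip_bimap mulC lP).
have frP := twist_bimap cc beta (flip_bimap mulC rP).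
exact: bimap_pair
  (bimap_add (bimap_add (bimap_comp brAP fstP fstP) (bimap_comp lP sndP fstP))
    (bimap_opp (bimap_comp flP fstP sndP)))
  (bimap_add (bimap_add (bimap_comp brLP sndP sndP) (bimap_comp rP sndP fstP))
    (bimap_opp (bimap_comp frP fstP sndP))).
Qed.

(** Only the two braided terms need an argument: they are braided by beta before
    twisting and by beta_sigma after, which [twist_braid] reconciles. *)
Lemma twist_double_cross_sum (beta sigma sigma' : form2 H) u v :
  mul2 sigma sigma' = one2 H ->
  twist sigma (double_cross_sum beta brA brL lact ract) u v =
  double_cross_sum (twisted_form beta sigma sigma') (twist sigma brA)
    (twist sigma brL) (twist sigma lact) (twist sigma ract) u v.
Proof.
move=> sigmaV.
have blP := act2_bilinear (form2P beta) (bilinear_flip lP.1).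
have brP := act2_bilinear (form2P beta) (bilinear_flip rP.1).
rewrite [LHS]surjective_pairing; congr (_, _).
  rewrite (linear_act2 _ _ _ _ (@fst_linear k H A L)) act2D act2D act2N.
  rewrite -(act2_map sigma u v brAP.1 fstP fstP).
  rewrite -(act2_map sigma u v lP.1 sndP fstP).
  rewrite -(act2_map sigma u v blP fstP sndP).
  by congr (_ - _); rewrite -(twist_braid cc _ sigmaV _ _ lP.1).
rewrite (linear_act2 _ _ _ _ (@snd_linear k H A L)) act2D act2D act2N.
rewrite -(act2_map sigma u v brLP.1 sndP sndP).
rewrite -(act2_map sigma u v rP.1 sndP fstP).
rewrite -(act2_map sigma u v brP fstP sndP).
by congr (_ - _); rewrite -(twist_braid cc _ sigmaV _ _ rP.1).
Qed.

Variable beta : form2 H.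
Hypothesis beta1_23 : form1_23 beta = mul3 (form12 beta) (form13 beta).
Hypothesis beta12_3 : form12_3 beta = mul3 (form23 beta) (form13 beta).
Hypothesis betaV : mul2 beta (flip2 beta) = one2 H.
Hypothesis AL_matched : matched_pair beta brA brL lact ract.

Local Notation D := (double_cross_sum beta brA brL lact ract).
Local Notation flact := (act2 beta (fun a h => lact h a)).
Local Notation fract := (act2 beta (fun a h => ract h a)).

Let flactP := act2_bilinear (form2P beta) (bilinear_flip lP.1).
Let fractP := act2_bilinear (form2P beta) (bilinear_flip rP.1).

Lemma double_cross_sum_antisym u v :
  D u v = - act2 beta (fun u v => D v u) u v.
Proof.
have antiA := lie_antisym (matched_pair_lieA AL_matched).
have antiL := lie_antisym (matched_pair_lieL AL_matched).
have swapE (X : lmodType k) (f : L -> A -> X) : bilinear_map f ->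
    act2 beta (fun u v => act2 beta (fun a h => f h a) v.1 u.2) u v = f u.2 v.1.
  move=> fP; have ffP := act2_bilinear (form2P beta) (bilinear_flip fP).
  rewrite -(act2_map beta u v (bilinear_flip ffP) sndP fstP).
  exact: braid_invol.
rewrite [RHS]surjective_pairing; congr (_, _).
  rewrite -[RHS]/(- (act2 beta (fun u v => D v u) u v).1).
  rewrite (linear_act2 _ _ _ _ (@fst_linear k H A L)) act2D act2D act2N.
  rewrite -(act2_map beta u v (bilinear_flip brAP.1) fstP fstP).
  rewrite -(act2_map beta u v (bilinear_flip lP.1) fstP sndP).
  by rewrite (swapE _ _ lP.1) /= antiA !opprD opprK addrAC.
rewrite -[RHS]/(- (act2 beta (fun u v => D v u) u v).2).
rewrite (linear_act2 _ _ _ _ (@snd_linear k H A L)) act2D act2D act2N.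
rewrite -(act2_map beta u v (bilinear_flip brLP.1) sndP sndP).
rewrite -(act2_map beta u v (bilinear_flip rP.1) fstP sndP).
by rewrite (swapE _ _ rP.1) /= antiL !opprD opprK addrAC.
Qed.

Lemma double_cross_sum_inA x b :
  D x (inA b) = (brA x.1 b + lact x.2 b, ract x.2 b).
Proof.
rewrite /double_cross_sum /= -/(flact x.1 0) -/(fract x.1 0).
rewrite (bilinear0r flactP) (bilinear0r fractP) (bilinear0r brLP.1).
by rewrite !subr0 add0r.
Qed.

Lemma double_cross_sum_inL x g :
  D x (inL g) = (- flact x.1 g, brL x.2 g - fract x.1 g).
Proof.
rewrite /double_cross_sum /= -/(flact x.1 g) -/(fract x.1 g).
by rewrite (bilinear0r lP.1) (bilinear0r rP.1) (bilinear0r brAP.1) !add0r addr0.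
Qed.

Lemma double_cross_sum_inLl h x :
  D (inL h) x = (lact h x.1, brL h x.2 + ract h x.1).
Proof.
rewrite /double_cross_sum /= -/(flact 0 x.2) -/(fract 0 x.2).
rewrite (bilinear0l flactP) (bilinear0l fractP) (bilinear0l brAP.1).
by rewrite !subr0 add0r.
Qed.

Lemma jacobiator_morph (M N : comodType H) (brM : M -> M -> M)
    (brN : N -> N -> N) (i : M -> N) a b c :
  comodule_bimap brN -> comodule_map i ->
  (forall x y, brN (i x) (i y) = i (brM x y)) ->
  jacobiator beta brN (i a) (i b) (i c) = i (jacobiator beta brM a b c).
Proof.
move=> [NP _] iP iM; have N3 := trilinear_nestl NP NP.
have addE x y : i (x + y) = i x + i y by rewrite -[x]scale1r iP.1 !scale1r.
rewrite /jacobiator !addE !iM !(linear_act3 _ _ _ _ _ iP.1).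
rewrite (act3_map (form1_23 beta) _ _ _ (trilinear_rotl N3) iP iP iP).
rewrite (act3_map (form12_3 beta) _ _ _ (trilinear_rotr N3) iP iP iP).
by congr (_ + _ + _); apply: eq_act3 => a' b' c'; rewrite !iM.
Qed.

(** Rotation invariance transports the vanishing of the Jacobi sum on a product
    of subcomodules to the rotated product. *)
Lemma jacobiator_rot_eq0 (M N P Q : comodType H) (br : Q -> Q -> Q)
    (e : M -> Q) (f : N -> Q) (g : P -> Q) :
  comodule_bimap br -> comodule_map e -> comodule_map f -> comodule_map g ->
  (forall x y z, jacobiator beta br (e x) (f y) (g z) = 0) ->
  forall z x y, jacobiator beta br (g z) (e x) (f y) = 0.
Proof.
move=> brP eP fP gP J0 z x y.
rewrite (jacobiator_rot cc beta1_23 beta12_3 betaV brP).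
have JP := trilinear_rotl (jacobiator_trilinear beta brP).
rewrite (act3_map (form1_23 beta) _ _ _ JP gP eP fP).
rewrite -[RHS](act3_0 Q (form1_23 beta) z x y).
by apply: eq_act3 => z' x' y'; exact: J0.
Qed.

Let DP := double_cross_sum_bimap beta.

Lemma double_cross_sum_leibniz u v w :
  jacobiator beta D u v w =
  D (D u v) w - D u (D v w) - act2 beta (fun v w => D (D u w) v) v w.
Proof.
exact (jacobiator_leibniz cc beta12_3 betaV DP double_cross_sum_antisym u v w).
Qed.

Lemma dsum_eq0 (x : (A * L)%type) : x.1 = 0 -> x.2 = 0 -> x = 0.
Proof. by case: x => a h /= -> ->. Qed.

Lemma double_cross_sum_LA h a : D (inL h) (inA a) = (lact h a, ract h a).
Proof. by rewrite double_cross_sum_inLl /= (bilinear0r brLP.1) add0r. Qed.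

Lemma double_cross_sum_AA a b : D (inA a) (inA b) = inA (brA a b).
Proof.
by rewrite double_cross_sum_inA /= (bilinear0l lP.1) (bilinear0l rP.1) addr0.
Qed.

Lemma double_cross_sum_LL h g : D (inL h) (inL g) = inL (brL h g).
Proof.
by rewrite double_cross_sum_inLl /= (bilinear0r lP.1) (bilinear0r rP.1) addr0.
Qed.

(** The A-component of the Leibniz defect is the compatibility of the left
    action with the bracket of A, its L-component the right module axiom. *)
Lemma double_cross_sum_jacobi_LAA h a b :
  jacobiator beta D (inL h) (inA a) (inA b) = 0.
Proof.
have [_ rmod] := matched_pair_right AL_matched.
have NP := trilinear_swap23 (trilinear_nestl DP.1 DP.1).
rewrite double_cross_sum_leibniz (act2_map beta _ _ (NP.2 _) inAP inAP).
rewrite (eq_act2 _ (G := fun a b => (brA (lact h b) a + lact (ract h b) a,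
  ract (ract h b) a) : (A * L)%type)); last first.
  by move=> a' b'; rewrite double_cross_sum_LA double_cross_sum_inA.
rewrite double_cross_sum_LA double_cross_sum_inA double_cross_sum_AA.
rewrite double_cross_sum_LA; apply: dsum_eq0.
  rewrite -[LHS]/(brA (lact h a) b + lact (ract h a) b - lact h (brA a b) -
    fst (act2 beta _ a b)) (linear_act2 _ _ _ _ (@fst_linear k H A L)) act2D.
  (* Antisymmetry puts the action on the right of the bracket; the braiding so
     created combines with the outer one. *)
  have -> : act2 beta (fun a b => brA (lact h b) a) a b =
      - act2 beta (fun h a => brA a (lact h b)) h a.
    rewrite -(braid_absorb beta12_3 betaV _ _ _ lP brAP.1) -act2N.
    apply: eq_act2 => a' b'.
    exact: (lie_antisym (matched_pair_lieA AL_matched)).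
  by rewrite (matched_pair_BB1 AL_matched); exact: cancel_left_compat.
rewrite -[LHS]/(ract (ract h a) b - ract h (brA a b) - snd (act2 beta _ a b)).
rewrite (linear_act2 _ _ _ _ (@snd_linear k H A L)) rmod.
exact: cancel_right_module.
Qed.

(** The A-component of the Leibniz defect is the left module axiom, its
    L-component the compatibility of the right action with the bracket of L. *)
Lemma double_cross_sum_jacobi_LLA h g a :
  jacobiator beta D (inL h) (inL g) (inA a) = 0.
Proof.
have [_ lmod] := matched_pair_left AL_matched.
have NP := trilinear_swap23 (trilinear_nestl DP.1 DP.1).
rewrite double_cross_sum_leibniz (act2_map beta _ _ (NP.2 _) inLP inAP).
rewrite (eq_act2 _ (G := fun g a => (- flact (lact h a) g,
  brL (ract h a) g - fract (lact h a) g) : (A * L)%type)); last first.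
  by move=> a' b'; rewrite double_cross_sum_LA double_cross_sum_inL.
rewrite double_cross_sum_LL !double_cross_sum_LA double_cross_sum_inLl.
apply: dsum_eq0.
  rewrite -[LHS]/(lact (brL h g) a - lact h (lact g a) - fst (act2 beta _ g a)).
  rewrite (linear_act2 _ _ _ _ (@fst_linear k H A L)) act2N.
  rewrite (braid_absorb beta12_3 betaV _ _ _ lP lP.1) lmod.
  exact: cancel_left_module.
rewrite -[LHS]/(ract (brL h g) a - (brL h (ract g a) + ract h (lact g a)) -
  snd (act2 beta _ g a)).
rewrite (linear_act2 _ _ _ _ (@snd_linear k H A L)) act2D act2N.
rewrite (braid_absorb beta12_3 betaV _ _ _ lP rP.1).
rewrite (matched_pair_BB2 AL_matched).
exact: cancel_right_compat.
Qed.

(** By trilinearity there are eight cases: on A and on L the Jacobi sum is the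
    given one, and the six mixed cases are the rotations of two. *)
Lemma double_cross_sum_lie : lie_algebra beta D.
Proof.
have lieA := matched_pair_lieA AL_matched.
have lieL := matched_pair_lieL AL_matched.
have rot := jacobiator_rot_eq0 DP.
split; [exact: DP|exact: double_cross_sum_antisym|].
apply: (trilinear_dsum_eq0 (jacobiator_trilinear beta DP)).
- move=> a b c; rewrite (jacobiator_morph _ _ _ DP inAP double_cross_sum_AA).
  rewrite (_ : jacobiator beta brA a b c = 0) //.
  exact: (lie_jacobi lieA a b c).
- exact: rot _ _ _ _ _ _ inAP inLP inAP
    (rot _ _ _ _ _ _ inLP inAP inAP double_cross_sum_jacobi_LAA).
- exact: rot _ _ _ _ _ _ inLP inAP inAP double_cross_sum_jacobi_LAA.
- exact: rot _ _ _ _ _ _ inLP inLP inAP double_cross_sum_jacobi_LLA.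
- exact: double_cross_sum_jacobi_LAA.
- exact: rot _ _ _ _ _ _ inAP inLP inLP
    (rot _ _ _ _ _ _ inLP inLP inAP double_cross_sum_jacobi_LLA).
- exact: double_cross_sum_jacobi_LLA.
move=> h g l; rewrite (jacobiator_morph _ _ _ DP inLP double_cross_sum_LL).
rewrite (_ : jacobiator beta brL h g l = 0) //.
exact: (lie_jacobi lieL h g l).
Qed.

End DoubleCrossSum.

(** * Cotriangular structures and cocycles as identities between forms *)

Section Cotriangular.
Variables (k : fieldType) (H : hopfAlgType k).

Lemma sum_counit2 (f : H -> k^o) h :
  linear f -> \sum_(x <- delta h) f x.1 * counit x.2 = f h.
Proof.
move=> fP; rewrite -[in RHS](counitr h) (linear_map_sum _ _ fP).
by apply: eq_bigr => x _; rewrite (linear_mapZ _ _ fP); exact: mulrC.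
Qed.

Variable beta : form2 H.
Hypothesis betaP : cotriangular beta.

Lemma cotriangular_1_23 : form1_23 beta = mul3 (form12 beta) (form13 beta).
Proof.
apply: form3_ext => h g l.
rewrite [RHS](act3_counit3 _ _ _ _ (form3P (form13 beta))).
rewrite [LHS](cotriangular2 betaP); apply: eq_bigr => x _ /=.
rewrite -(sum_counit2 _ ((form2P beta).2 x.1)) mulr_suml.
by apply: eq_bigr => y _; rewrite -mulrA (mulrC (counit _)).
Qed.

Lemma cotriangular_12_3 : form12_3 beta = mul3 (form23 beta) (form13 beta).
Proof.
apply: form3_ext => h g l.
rewrite [RHS](act3_counit1 _ _ _ _ (form3P (form13 beta))).
rewrite [LHS](cotriangular3 betaP) [RHS]exchange_big; apply: eq_bigr => z _ /=.
rewrite -(sum_counit2 _ ((form2P beta).1 z.1)) mulr_suml.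
by apply: eq_bigr => y _; rewrite -mulrA (mulrC (counit _)).
Qed.

Lemma cotriangularV : mul2 beta (flip2 beta) = one2 H.
Proof.
by apply: form2_ext => h g; rewrite [LHS](cotriangular4 betaP); exact: mulrC.
Qed.

Variable sigma : form2 H.
Hypothesis sigmaP : left_cocycle sigma.

Lemma left_cocycle_form3 :
  mul3 (form12 sigma) (form12_3 sigma) = mul3 (form23 sigma) (form1_23 sigma).
Proof.
apply: form3_ext => h g l.
rewrite [LHS](act3_counit3 _ _ _ _ (form3P (form12_3 sigma))).
rewrite [RHS](act3_counit1 _ _ _ _ (form3P (form1_23 sigma))).
exact: left_cocycleE sigmaP h g l.
Qed.

Lemma twist_formE (sigma' : form2 H) :
  form2_fun sigma' = conv_inv sigma ->
  twist_form sigma beta = twisted_form beta sigma sigma'.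
Proof.
move=> E; apply: funext => h; apply: funext => l.
rewrite /twist_form /delta3 big_allpairs_dep.
transitivity (\sum_(x <- delta h) \sum_(y <- delta l)
   sigma' y.1 x.1 * mul2 beta sigma x.2 y.2); last by [].
apply: eq_bigr => x _; under eq_bigr do rewrite big_allpairs_dep.
rewrite exchange_big; apply: eq_bigr => y _ /=.
rewrite E mulr_sumr; apply: eq_bigr => x' _.
by rewrite mulr_sumr; apply: eq_bigr => y' _; exact/esym/mulrA.
Qed.

End Cotriangular.

Theorem theorem3p1 (k : fieldType) (H : hopfAlgType k)
    (beta sigma : H -> H -> k) (A L : comodType H)
    (brA : A -> A -> A) (brL : L -> L -> L)
    (lact : L -> A -> A) (ract : L -> A -> L)
    (H_commutative : forall h g : H, h * g = g * h)
    (H_cocommutative : cocommutative H)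
    (H_cotriangular : cotriangular beta)
    (sigma_cocycle : left_cocycle sigma)
    (AL_matched : matched_pair beta brA brL lact ract) :
  matched_pair (twist_form sigma beta) (twist sigma brA) (twist sigma brL)
    (twist sigma lact) (twist sigma ract) /\
  lie_algebra (twist_form sigma beta)
    (double_cross_sum (twist_form sigma beta) (twist sigma brA)
      (twist sigma brL) (twist sigma lact) (twist sigma ract)).
Proof.
pose b := Form2 (cotriangular_bilinear H_cotriangular).
pose s := Form2 (left_cocycle_bilinear sigma_cocycle).
have [s'P sV _] := conv_invP (left_cocycle_invertible sigma_cocycle).
pose s' := Form2 s'P.
have ssV : mul2 s s' = one2 H by apply: form2_ext => h g; exact: sV.
have sE : mul3 (form12 s) (form12_3 s) = mul3 (form23 s) (form1_23 s).
  exact: (@left_cocycle_form3 _ _ s).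
rewrite (_ : twist_form sigma beta = twisted_form b s s'); last first.
  exact: (@twist_formE _ _ b s).
split.
  exact (twist_matched_pair H_commutative H_cocommutative (beta := b) ssV sE
    AL_matched).
have brAP := lie_comodule_bimap (matched_pair_lieA AL_matched).
have brLP := lie_comodule_bimap (matched_pair_lieL AL_matched).
have [lP _] := matched_pair_left AL_matched.
have [rP _] := matched_pair_right AL_matched.
have lieD : lie_algebra b (double_cross_sum b brA brL lact ract).
  apply: double_cross_sum_lie => //.
  - exact: (@cotriangular_1_23 _ _ b).
  - exact: (@cotriangular_12_3 _ _ b).
  - exact: (@cotriangularV _ _ b).
have := twist_lie H_cocommutative ssV sE lieD.
congr lie_algebra; do 2![apply: funext => ?].
exact: twist_double_cross_sum.
Qed.
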